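(* Let $P_n(y)=\frac{1}{2^n n!}\frac{d^n}{dy^n}\big((y^2-1)^n\big)$ be the Legendre polynomials and $F_{P^3}(y,z)=\sum_{n\ge0}P_n(y)^3z^n\in\mathbb{Q}[y][[z]]$. Let \[ p=1-xy^3+\tfrac{x^2(3y^2-2)}{4},\qquad H=\frac{1}{\sqrt p}\;{}_2F_1\!\left(\frac14,\frac34;1;\frac{(y^2-1)^3\,(x^2-\frac14x^4)}{p^2}\right)\in\mathbb{Q}[y][[x]]. \] Then \[ F_{P^3}(y,z)=\frac{1}{\sqrt{1+z^2}}\left(H\star\frac{1}{\sqrt{1-4x}}\right)\bigg|_{x=z/(1+z^2)}, \] where $\star$ is the Hadamard product with respect to $x$.
   Context: ${}_2F_1(a,b;c;X)=\sum_{n\ge0}\frac{(a)_n(b)_n}{n!(c)_n}X^n$ with $(a)_n=a(a+1)\cdots(a+n-1)$. The Hadamard product of power series in $x$ is $\big(\sum a_nx^n\big)\star\big(\sum b_nx^n\big)=\sum a_nb_nx^n$; note $\frac{1}{\sqrt{1-4x}}=\sum_n\binom{2n}{n}x^n$. Square roots of power series with constant term $1$ are the ones with constant term $1$. *)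

(* Defs.v *)
(* The classical axioms are used for extensionality of coefficient sequences and
   for the choice of inverses and square roots. *)
From HB Require Import structures.
From mathcomp Require Import all_boot all_order all_algebra.
From mathcomp Require Import boolp classical_sets.

Set Implicit Arguments.
Unset Strict Implicit.
Unset Printing Implicit Defensive.
Import Order.TTheory GRing.Theory Num.Theory.
Local Open Scope ring_scope.

Record fps (R : Type) := FPS { fps_coef :> nat -> R }.
Notation "{ 'fps' R }" := (fps R) (at level 0, format "{ 'fps'  R }") : type_scope.

Lemma fpsP (R : Type) (f g : {fps R}) : f =1 g <-> f = g.
Proof.
by split=> [|-> //]; case: f g => [f] [g] /= fg; congr FPS; apply/funext.
Qed.

HB.instance Definition _ (R : Type) := gen_eqMixin {fps R}.
HB.instance Definition _ (R : Type) := gen_choiceMixin {fps R}.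

Section Ring.
Variable R : comNzRingType.
Implicit Types f g h : {fps R}.

Definition fpsC (c : R) : {fps R} := FPS (fun n => if n == 0%N then c else 0).
Definition fpsX : {fps R} := FPS (fun n => (n == 1%N)%:R).
Definition fps_add f g : {fps R} := FPS (fun n => f n + g n).
Definition fps_opp f : {fps R} := FPS (fun n => - f n).
Definition fps_mul f g : {fps R} :=
  FPS (fun n => \sum_(i < n.+1) f i * g (n - i)%N).

Fact fps_addA : associative fps_add.
Proof. by move=> f g h; apply/fpsP => n /=; rewrite addrA. Qed.
Fact fps_addC : commutative fps_add.
Proof. by move=> f g; apply/fpsP => n /=; rewrite addrC. Qed.
Fact fps_add0 : left_id (fpsC 0) fps_add.
Proof. by move=> f; apply/fpsP => n /=; rewrite if_same add0r. Qed.
Fact fps_addN : left_inverse (fpsC 0) fps_opp fps_add.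
Proof. by move=> f; apply/fpsP => n /=; rewrite addNr if_same. Qed.

HB.instance Definition _ :=
  GRing.isZmodule.Build {fps R} fps_addA fps_addC fps_add0 fps_addN.

Definition fps_trunc m f : {poly R} := \poly_(i < m.+1) f i.

Lemma coef_fps_trunc m f n : (n <= m)%N -> (fps_trunc m f)`_n = f n.
Proof. by move=> le_nm; rewrite coef_poly ltnS le_nm. Qed.

Lemma fps_mul_trunc m f g n : (n <= m)%N ->
  fps_mul f g n = (fps_trunc m f * fps_trunc m g)`_n.
Proof.
move=> le_nm; rewrite coefM; apply: eq_bigr => i _.
rewrite !coef_fps_trunc //; last by rewrite -ltnS (leq_trans (ltn_ord i)).
exact: leq_trans (leq_subr _ _) le_nm.
Qed.

Fact fps_mulC : commutative fps_mul.
Proof.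
by move=> f g; apply/fpsP => n; rewrite !(@fps_mul_trunc n) // mulrC.
Qed.
Fact fps_mulA : associative fps_mul.
Proof.
move=> f g h; apply/fpsP => n.
transitivity ((fps_trunc n f * (fps_trunc n g * fps_trunc n h))`_n).
  rewrite coefM; apply: eq_bigr => i _.
  by rewrite coef_fps_trunc -?(@fps_mul_trunc n) ?leq_subr // -ltnS.
rewrite mulrA coefM; apply: eq_bigr => i _.
by rewrite coef_fps_trunc ?leq_subr // -(@fps_mul_trunc n) // -ltnS.
Qed.
Fact fps_mul1 : left_id (fpsC 1) fps_mul.
Proof.
move=> f; apply/fpsP => n /=; rewrite big_ord_recl /= mul1r subn0 big1 ?addr0 //.
by move=> i _; rewrite mul0r.
Qed.
Fact fps_mulDl : left_distributive fps_mul fps_add.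
Proof.
move=> f g h; apply/fpsP => n /=; rewrite -big_split /=.
by apply: eq_bigr => i _; rewrite mulrDl.
Qed.
Fact fps_1neq0 : fpsC 1 != 0.
Proof. by apply/eqP => /fpsP/(_ 0%N) /= /eqP; rewrite oner_eq0. Qed.

HB.instance Definition _ := GRing.Zmodule_isComNzRing.Build {fps R}
  fps_mulA fps_mulC fps_mul1 fps_mulDl fps_1neq0.

Lemma fps_coef0 n : (0 : {fps R}) n = 0.
Proof. by rewrite /= if_same. Qed.
Lemma fps_coef1 n : (1 : {fps R}) n = (n == 0%N)%:R.
Proof. by case: n. Qed.
Lemma fps_coefD f g n : (f + g) n = f n + g n.
Proof. by []. Qed.
Lemma fps_coefN f n : (- f) n = - f n.
Proof. by []. Qed.
Lemma fps_coefM f g n : (f * g) n = \sum_(i < n.+1) f i * g (n - i)%N.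
Proof. by []. Qed.
Lemma fps_coef0M f g : (f * g) 0%N = f 0%N * g 0%N.
Proof. by rewrite fps_coefM big_ord1. Qed.
Lemma fps_coefMn f k n : (f *+ k) n = f n *+ k.
Proof.
by elim: k => [|k IH]; rewrite ?mulr0n ?fps_coef0 // !mulrS fps_coefD IH.
Qed.

(* g is meant to have zero constant term: then (g ^+ k) n = 0 for k > n, so
   that the sum is the whole n-th coefficient of f(g). *)
Definition fps_comp f g : {fps R} :=
  FPS (fun n => \sum_(k < n.+1) f k * (g ^+ k) n).

Lemma fps_exp_low g k n : g 0%N = 0 -> (n < k)%N -> (g ^+ k) n = 0.
Proof.
move=> g0; elim: k n => // k IHk n lt_nk; rewrite exprS fps_coefM big1 // => i _.
case: i => -[|i] lt_in /=; first by rewrite g0 mul0r.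
rewrite IHk ?mulr0 //; case: n lt_in lt_nk => // n _; rewrite ltnS subSS.
exact: leq_ltn_trans (leq_subr _ _).
Qed.

Definition hadamard f g : {fps R} := FPS (fun n => f n * g n).

Definition fps_sqrt f : {fps R} :=
  xget 0 [set s : {fps R} | s 0%N = 1 /\ s ^+ 2 = f].

End Ring.

Arguments fpsX {R}.
Arguments fps_sqrt {R} f.

Notation "c %:S" := (fpsC c) (at level 2, left associativity, format "c %:S") : ring_scope.
Notation "f \oS g" := (fps_comp f g) (at level 50) : ring_scope.
Notation "f ⋆ g" := (hadamard f g) (at level 40, left associativity) : ring_scope.

Lemma course_of_values (T : Type) (x0 : T) (Phi : (nat -> T) -> nat -> T) :
    (forall u v n, (forall k, (k < n)%N -> u k = v k) -> Phi u n = Phi v n) ->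
  exists u, forall n, u n = Phi u n.
Proof.
move=> PhiE; pose it m := iter m Phi (fun=> x0).
have stable m n k : (k < m)%N -> (k < n)%N -> it m k = it n k.
  elim: m n k => // m IHm [|n] k // le_km le_kn /=; apply: PhiE => i lt_ik.
  by apply: IHm; apply: leq_trans lt_ik _.
exists (fun n => it n.+1 n) => n /=; apply: PhiE => k lt_kn.
exact: (stable n k.+1 k lt_kn (ltnSn k)).
Qed.

Section UnitRing.
Variable R : comUnitRingType.
Implicit Types f g s : {fps R}.

Definition fps_unit : pred {fps R} := fun f => f 0%N \is a GRing.unit.
Definition fps_inv f : {fps R} := xget f [set g | g * f = 1].

Lemma fps_inv_exists f : fps_unit f -> exists g, g * f = 1.
Proof.
move=> Uf; pose Phi (u : nat -> R) n :=
  ((n == 0%N)%:R - \sum_(i < n) u i * f (n - i)%N) / f 0%N.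
have [|u uE] := @course_of_values R 0 Phi.
  move=> u v n uv; rewrite /Phi; congr ((_ - _) / _).
  by apply: eq_bigr => i _; rewrite uv.
exists (FPS u); apply/fpsP => n; rewrite fps_coefM big_ord_recr /= subnn.
by rewrite uE mulrVK // addrC subrK; case: n.
Qed.

Fact fps_mulVr : {in fps_unit, left_inverse 1 fps_inv *%R}.
Proof.
move=> f Uf; have [g gf] := fps_inv_exists Uf.
exact: (@xgetI _ f [set g | g * f = 1] g gf).
Qed.
Fact fps_unitP f g : g * f = 1 -> fps_unit f.
Proof.
move=> /fpsP/(_ 0%N); rewrite fps_coef0M fps_coef1 /fps_unit => gf.
by apply/unitrPr; exists (g 0%N); rewrite mulrC.
Qed.
Fact fps_inv_out : {in [predC fps_unit], fps_inv =1 id}.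
Proof.
move=> f; rewrite inE => nUf; rewrite /fps_inv; case: xgetP => // g _ /= gf.
by case/negP: nUf; apply: fps_unitP gf.
Qed.

HB.instance Definition _ := GRing.ComNzRing_hasMulInverse.Build {fps R}
  fps_mulVr fps_unitP fps_inv_out.

Lemma fps_unitE f : (f \is a GRing.unit) = (f 0%N \is a GRing.unit).
Proof. by []. Qed.

Lemma fps_sqrtP f : (2 : R) \is a GRing.unit -> f 0%N = 1 ->
  fps_sqrt f 0%N = 1 /\ fps_sqrt f ^+ 2 = f.
Proof.
move=> U2 f0; pose Phi (u : nat -> R) n := if n is n'.+1 then
  (f n'.+1 - \sum_(i < n') u i.+1 * u (n' - i)%N) / 2 else 1.
have [|u uE] := @course_of_values R 0 Phi.
  move=> u v [|n] uv //; rewrite /Phi; congr ((_ - _) / _).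
  by apply: eq_bigr => i _; rewrite !uv // ltnS ?leq_subr.
suff us : (FPS u) 0%N = 1 /\ (FPS u) ^+ 2 = f.
  exact: (@xgetI _ 0 [set s : {fps R} | s 0%N = 1 /\ s ^+ 2 = f] _ us).
split; first by rewrite /= uE.
have u0 : u 0%N = 1 by rewrite uE.
apply/fpsP => -[|n]; first by rewrite expr2 fps_coef0M /= u0 mulr1 f0.
rewrite expr2 fps_coefM big_ord_recl big_ord_recr /= subnn subn0 u0 mul1r mulr1.
rewrite addrCA -mulr2n -mulr_natr [u n.+1]uE /Phi mulrVK //.
by rewrite addrC subrK.
Qed.

Lemma fps_sqrt_unique f s :
  (2 : R) \is a GRing.unit -> s 0%N = 1 -> s ^+ 2 = f -> fps_sqrt f = s.
Proof.
move=> U2 s0 sf; have [|r0 rf] := @fps_sqrtP f U2.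
  by rewrite -sf expr2 fps_coef0M s0 mulr1.
move: (fps_sqrt f) r0 rf => r r0 rf; apply/eqP; rewrite -subr_eq0.
have Urs : r + s \is a GRing.unit by rewrite fps_unitE fps_coefD r0 s0.
by rewrite -(inj_eq (mulIr Urs)) mul0r -subr_sqr rf sf subrr.
Qed.

Definition pochhammer (a : R) n : R := \prod_(k < n) (a + k%:R).

Definition hyp2F1 (a b c : R) (X : {fps R}) : {fps R} :=
  FPS (fun n => pochhammer a n * pochhammer b n / (n`!%:R * pochhammer c n))
    \oS X.

End UnitRing.

Definition legendre n : {poly rat} :=
  ((2 ^+ n * n`!%:R)^-1 : rat) *: (('X^2 - 1) ^+ n)^`(n).

Definition legendre_cube_gf : {fps {poly rat}} := FPS (fun n => legendre n ^+ 3).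

Section Series.
Local Notation y := ('X%:S : {fps {poly rat}}).
Local Notation x := (fpsX : {fps {poly rat}}).

Definition p_series : {fps {poly rat}} :=
  1 - x * y ^+ 3 + x ^+ 2 * (3 * y ^+ 2 - 2) / 4.

Definition H_series : {fps {poly rat}} :=
  (fps_sqrt p_series)^-1 *
  hyp2F1 (1 / 4) (3 / 4) 1
    ((y ^+ 2 - 1) ^+ 3 * (x ^+ 2 - 1 / 4 * x ^+ 4) / p_series ^+ 2).

(* The inverses, the square root and the substitution in H_series are not junk
   values. *)
Lemma poly_natr_unit n : (n.+1%:R : {poly rat}) \is a GRing.unit.
Proof. by rewrite -polyC_natr rmorph_unit // unitfE pnatr_eq0. Qed.

Lemma fps_natr_unit n : (n.+1%:R : {fps {poly rat}}) \is a GRing.unit.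
Proof. by rewrite fps_unitE fps_coefMn fps_coef1 poly_natr_unit. Qed.

Lemma p_series0 : p_series 0%N = 1.
Proof.
by rewrite /p_series !(fps_coefD, fps_coefN, fps_coef0M, exprS) /= !mul0r oppr0 !addr0.
Qed.

Lemma p_series_unit : p_series \is a GRing.unit.
Proof. by rewrite fps_unitE p_series0 unitr1. Qed.

Lemma sqrt_p_series : fps_sqrt p_series 0%N = 1 /\ fps_sqrt p_series ^+ 2 = p_series.
Proof. exact: (fps_sqrtP (poly_natr_unit 1) p_series0). Qed.

Lemma hyp2F1_arg0 :
  ((y ^+ 2 - 1) ^+ 3 * (x ^+ 2 - 1 / 4 * x ^+ 4) / p_series ^+ 2) 0%N = 0.
Proof.
have x0 k : (x ^+ k.+1) 0%N = 0 by apply: fps_exp_low.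
have r0 : (x ^+ 2 - 1 / 4 * x ^+ 4) 0%N = 0.
  by rewrite fps_coefD fps_coefN x0 fps_coef0M x0 mulr0 subrr.
by rewrite -mulrA mulrCA fps_coef0M r0 mul0r.
Qed.

End Series.

(* Main.v *)
(* Let L_y be the linear map on polynomials in t sending t^n to g_n(y,w), where
     sum_n g_n(y,w) X^n = (1 - 2ywX + X^2(y^2 + w^2 - 1))^(-1/2).
   This is the average over a circle in the classical product formula, which reads
   L_y P_n = P_n(y) P_n(w): both sides satisfy the Legendre equation in w and agree at w = 1.
   Setting w = y in g_n gives a functional diag with diag P_n = P_n(y)^2, so that the functional
   t^n |-> k_n := diag(g_n(y, .)) sends P_n to P_n(y)^3.  Applying the latter coefficientwise to
     sum_n P_n(t) z^n = (1 - 2tz + z^2)^(-1/2) = (1 + z^2)^(-1/2) (1 - 2t z/(1 + z^2))^(-1/2)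
   reduces the theorem to k_n = 2^n [x^n] H.  The functional diag kills
     (w^2 - 2y^2 w + 2y^2 - 1) f' + (w - y^2) f,
   and creative telescoping in w then yields a second order differential equation for
   sum_n k_n X^n; the series H(2X) satisfies the same equation, whose power series solutions are
   determined by their constant term. *)
From HB Require Import structures.
Require Import Defs.
From mathcomp Require Import all_boot all_order all_algebra.
From mathcomp Require Import ring.
Set Implicit Arguments.
Unset Strict Implicit.
Unset Printing Implicit Defensive.
Import GRing.Theory Num.Theory.
Local Open Scope ring_scope.

(** * The kernel and the polynomials of the certificates *)

(** Equal to (1 - ywX)^2 - (1 - y^2)(1 - w^2)X^2, so its inverse square root is formally the average
    over t of 1/(1 - X(yw + sqrt((1 - y^2)(1 - w^2)) cos t)). *)
Definition kernel_poly (T : comNzRingType) (y w X : T) :=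
  1 - 2 * y * w * X + X ^+ 2 * (y ^+ 2 + w ^+ 2 - 1).

Lemma rmorph_kernel_poly (T T' : comNzRingType) (f : {rmorphism T -> T'}) y w X :
  f (kernel_poly y w X) = kernel_poly (f y) (f w) (f X).
Proof. by rewrite /kernel_poly !(rmorphXn, rmorph_nat, rmorph1, rmorphB, rmorphD, rmorphM). Qed.

(* Found by solving a linear system for a polynomial r, quadratic in w, such that r kernel^3
   telescopes the operator ode2 d^2/dX^2 + ode1 d/dX + ode0 applied to the kernel; see cert_id. *)
Definition cert (T : comNzRingType) (y w X : T) :=
  y + y ^+ 2 * X - y * X ^+ 2 + y ^+ 3 * X ^+ 2 + 3 * y ^+ 2 * X ^+ 3
  - 5 * y ^+ 4 * X ^+ 3 + y * X ^+ 4 + y ^+ 3 * X ^+ 4 - 2 * y ^+ 5 * X ^+ 4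
  + (- X - 4 * y * X ^+ 2 + 4 * y ^+ 3 * X ^+ 2 - y ^+ 2 * X ^+ 3 + 2 * y ^+ 3 * X ^+ 4) * w
  + (- y ^+ 2 * X ^+ 3 - y * X ^+ 4 + 2 * y ^+ 3 * X ^+ 4) * w ^+ 2.
Definition dcert (T : comNzRingType) (y w X : T) :=
  (- X - 4 * y * X ^+ 2 + 4 * y ^+ 3 * X ^+ 2 - y ^+ 2 * X ^+ 3 + 2 * y ^+ 3 * X ^+ 4)
  + 2 * (- y ^+ 2 * X ^+ 3 - y * X ^+ 4 + 2 * y ^+ 3 * X ^+ 4) * w.

(* At x = 2X: p of the theorem and its X-derivatives, the numerator q of the hypergeometric
   argument q / p^2, and the numerator q' p - 2 q p' of its derivative (over p^3). *)
Section HypergeometricArgument.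
Variables (T : comNzRingType) (y X : T).
Definition scaled_p := 1 - 2 * y ^+ 3 * X + (3 * y ^+ 2 - 2) * X ^+ 2.
Definition scaled_p1 := 2 * (3 * y ^+ 2 - 2) * X - 2 * y ^+ 3.
Definition scaled_p2 := 2 * (3 * y ^+ 2 - 2).
Definition scaled_q := 4 * (y ^+ 2 - 1) ^+ 3 * (X ^+ 2 - X ^+ 4).
Definition wronsk := 8 * (y ^+ 2 - 1) ^+ 3 * X * (1 - 3 * y ^+ 2 * X ^+ 2 + 2 * y ^+ 3 * X ^+ 3).
Definition wronsk1 := 8 * (y ^+ 2 - 1) ^+ 3 * (1 - 9 * y ^+ 2 * X ^+ 2 + 8 * y ^+ 3 * X ^+ 3).
End HypergeometricArgument.

(** * Derivations of inverse square roots *)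

Section Derivation.
Variables (T : comNzRingType) (d : {additive T -> T}).
Hypothesis dM : forall a b, d (a * b) = d a * b + a * d b.

Lemma der1 : d 1 = 0.
Proof. by apply: (addrI (d 1)); rewrite -[in RHS](mulr1 1) dM mulr1 mul1r addr0. Qed.

Lemma derX2 a : d (a ^+ 2) = 2 * a * d a.
Proof. by rewrite expr2 dM; ring. Qed.

Lemma derX3 a : d (a ^+ 3) = 3 * a ^+ 2 * d a.
Proof. by rewrite exprS dM derX2; ring. Qed.

Lemma der_nat n : d n%:R = 0.
Proof. by rewrite raddfMn der1 mul0rn. Qed.

(** Here g is D^(-1/2): multiplying the derivative of D g^2 = 1 by g gives g' = -D^(-3/2) D'/2,
    stated without division and with g^3 for D^(-3/2). *)
Lemma der_rsqrt D g : D * g ^+ 2 = 1 -> 2 * d g = - g ^+ 3 * d D.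
Proof.
move=> Dg; have := congr1 d Dg; rewrite der1 dM derX2 => /eqP.
rewrite addr_eq0 => /eqP E.
have -> : 2 * d g = D * g ^+ 2 * (2 * d g) by rewrite Dg mul1r.
have -> : - g ^+ 3 * d D = - g * (d D * g ^+ 2) by ring.
by rewrite E; ring.
Qed.

Lemma der_rsqrt2 D g : D * g ^+ 2 = 1 ->
  4 * d (d g) = 3 * g ^+ 5 * d D ^+ 2 - 2 * g ^+ 3 * d (d D).
Proof.
move=> Dg; have E := der_rsqrt Dg; have := congr1 d E.
rewrite mulNr raddfN [d (2 * _)]dM [d (g ^+ 3 * _)]dM der_nat derX3 => E2.
have -> : 4 * d (d g) = 2 * (0 * d g + 2 * d (d g)) by ring.
rewrite E2.
have -> : 2 * - (3 * g ^+ 2 * d g * d D + g ^+ 3 * d (d D)) =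
   - 3 * g ^+ 2 * d D * (2 * d g) - 2 * g ^+ 3 * d (d D) by ring.
by rewrite E; ring.
Qed.

Lemma der_kernel_poly_X y w X : d y = 0 -> d w = 0 -> d X = 1 ->
  d (kernel_poly y w X) = 2 * X * (y ^+ 2 + w ^+ 2 - 1) - 2 * y * w /\
  d (2 * X * (y ^+ 2 + w ^+ 2 - 1) - 2 * y * w) = 2 * (y ^+ 2 + w ^+ 2 - 1).
Proof.
move=> dy dw dX; have dd : d (y ^+ 2 + w ^+ 2 - 1) = 0.
  by rewrite raddfB raddfD /= !derX2 der1 dy dw; ring.
rewrite /kernel_poly raddfD raddfB [d (2 * X * _ - _)]raddfB /=.
rewrite [d (X ^+ 2 * _)]dM [d (2 * X * _)]dM [d (2 * X)]dM.
rewrite [d (2 * y * w * X)]dM [d (2 * y * w)]dM [d (2 * y)]dM.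
by rewrite derX2 dd der1 der_nat dX dy dw; split; ring.
Qed.

Lemma der_kernel_poly_w y w X : d y = 0 -> d w = 1 -> d X = 0 ->
  d (kernel_poly y w X) = 2 * w * X ^+ 2 - 2 * y * X /\
  d (2 * w * X ^+ 2 - 2 * y * X) = 2 * X ^+ 2.
Proof.
move=> dy dw dX; have dd : d (y ^+ 2 + w ^+ 2 - 1) = 2 * w.
  by rewrite raddfB raddfD /= !derX2 der1 dy dw; ring.
rewrite /kernel_poly raddfD raddfB [d (2 * w * _ - _)]raddfB /=.
rewrite [d (X ^+ 2 * _)]dM [d (2 * w * _)]dM [d (2 * w)]dM [d (2 * y * X)]dM.
rewrite [d (2 * y * w * X)]dM [d (2 * y * w)]dM [d (2 * y)]dM.
by rewrite derX2 dd der1 der_nat dX dy dw; split; ring.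
Qed.

Lemma derX_const a n : d a = 0 -> d (a ^+ n) = 0.
Proof.
by move=> da; elim: n => [|n IHn]; rewrite ?der1 // exprS dM da IHn mul0r mulr0 addr0.
Qed.

Lemma der_cert y w X : d y = 0 -> d w = 1 -> d X = 0 -> d (cert y w X) = dcert y w X.
Proof.
move=> dy dw dX; have dyn n := derX_const n dy; have dXn n := derX_const n dX.
rewrite /cert !(dyn, dXn, derX2, dy, dX, dw, der_nat, raddfN, raddfB, raddfD, dM) /=.
by rewrite /dcert; ring.
Qed.

Lemma derX4 a : d (a ^+ 4) = 4 * a ^+ 3 * d a.
Proof. by rewrite exprS dM derX3; ring. Qed.

Lemma der_hyp y X : d y = 0 -> d X = 1 ->
  [/\ d (scaled_p y X) = scaled_p1 y X, d (scaled_p1 y X) = scaled_p2 y,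
      d (scaled_q y X) = 4 * (y ^+ 2 - 1) ^+ 3 * (2 * X - 4 * X ^+ 3) 
      & d (wronsk y X) = wronsk1 y X].
Proof.
move=> dy dX; have dyn n := derX_const n dy; pose k := (y ^+ 2 - 1) ^+ 3.
have dk : d k = 0 by rewrite derX_const // raddfB /= dyn der1 subr0.
rewrite /scaled_p /scaled_p1 /scaled_p2 /scaled_q /wronsk /wronsk1 -/k.
by split; rewrite !(dk, dyn, der1, der_nat, derX2, derX3, derX4, dy, dX,
  raddfN, raddfB, raddfD, dM) /=; ring.
Qed.

Lemma der_hyp_arg y X g : d y = 0 -> d X = 1 -> scaled_p y X * g ^+ 2 = 1 ->
  d (scaled_q y X * g ^+ 4) = wronsk y X * g ^+ 6 /\
  d (wronsk y X * g ^+ 6) = wronsk1 y X * g ^+ 6 - 3 * scaled_p1 y X * wronsk y X * g ^+ 8.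
Proof.
move=> dy dX pg; have [pE _ qE mE] := der_hyp dy dX; have := der_rsqrt pg.
rewrite pE => g1; split.
  rewrite dM qE derX4.
  transitivity (4 * (y ^+ 2 - 1) ^+ 3 * (2 * X - 4 * X ^+ 3) * g ^+ 4
     + 2 * scaled_q y X * g ^+ 3 * (2 * d g)); first by ring.
  rewrite g1; have -> : g ^+ 4 = scaled_p y X * g ^+ 6 by rewrite -[LHS]mul1r -pg; ring.
  by rewrite /scaled_q /wronsk /scaled_p /scaled_p1; ring.
have -> : g ^+ 6 = (g ^+ 3) ^+ 2 by ring.
rewrite dM mE derX2 derX3.
transitivity (wronsk1 y X * g ^+ 6 + 3 * wronsk y X * g ^+ 5 * (2 * d g)); first by ring.
by rewrite g1; ring.
Qed.

End Derivation.

(* The second order equation in X satisfied by H(2X), obtained from the hypergeometric equation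
   by the change of variable and the factor p^(-1/2), and cleared of denominators. *)
Definition ode2 (T : comNzRingType) (y X : T) :=
  X * (1 - X ^+ 2) * (1 - y * X) * (1 + (3 * y - 4 * y ^+ 3) * X) * (1 + 2 * y * X).
Definition ode1 (T : comNzRingType) (y X : T) :=
  1 + X * (4 * y - 8 * y ^+ 3 - 3 * X - 5 * y ^+ 2 * X + 4 * y ^+ 4 * X
  - 12 * y * X ^+ 2 + 4 * y ^+ 3 * X ^+ 2 + 16 * y ^+ 5 * X ^+ 2 + 3 * y ^+ 2 * X ^+ 3
  + 4 * y ^+ 4 * X ^+ 3 + 24 * y ^+ 3 * X ^+ 4 - 32 * y ^+ 5 * X ^+ 4).
Definition ode0 (T : comNzRingType) (y X : T) :=
  - y ^+ 3 - X - 3 * y ^+ 2 * X + 5 * y ^+ 4 * X - 4 * y * X ^+ 2 + 5 * y ^+ 3 * X ^+ 2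
  + 2 * y ^+ 5 * X ^+ 2 + 5 * y ^+ 2 * X ^+ 3 - 4 * y ^+ 4 * X ^+ 3
  + 12 * y ^+ 3 * X ^+ 4 - 16 * y ^+ 5 * X ^+ 4.

(** * Polynomial identities behind the differential equations *)

Section Certificates.
Variable T : comNzRingType.
Implicit Types y w X g : T.

(** Generating function form of the recurrence [legop_kernel]: X^2 d^2 + 2X d multiplies X^n by n(n
    + 1), and X^2 d^2 + 4X d + 2 by (n + 1)(n + 2). The variables g1, g2 and h1, h2 stand for the
    derivatives of g = D^(-1/2) in X and in w. *)
Lemma kernel_pde_id y w X g g1 g2 h1 h2 (D := kernel_poly y w X)
    (D1 := 2 * X * (y ^+ 2 + w ^+ 2 - 1) - 2 * y * w) (D2 := 2 * (y ^+ 2 + w ^+ 2 - 1))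
    (E1 := 2 * w * X ^+ 2 - 2 * y * X) (E2 := 2 * X ^+ 2) :
  D * g ^+ 2 = 1 ->
  2 * g1 = - g ^+ 3 * D1 -> 4 * g2 = 3 * g ^+ 5 * D1 ^+ 2 - 2 * g ^+ 3 * D2 ->
  2 * h1 = - g ^+ 3 * E1 -> 4 * h2 = 3 * g ^+ 5 * E1 ^+ 2 - 2 * g ^+ 3 * E2 ->
  4 * ((1 - w ^+ 2) * h2 - 2 * w * h1 + X ^+ 2 * g2 + 2 * X * g1
       - X ^+ 2 * (X ^+ 2 * g2 + 4 * X * g1 + 2 * g)) = 0.
Proof.
move=> Dg e1 e2 f1 f2.
(* Factors D g^2 = 1 bring every term to g^5 times a polynomial. *)
have g3 : g ^+ 3 = D * g ^+ 5 by rewrite -[LHS]mul1r -Dg; ring.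
have gE : g = D ^+ 2 * g ^+ 5 by rewrite -[LHS]mul1r -(expr1n T 2) -Dg; ring.
transitivity ((1 - w ^+ 2) * (4 * h2) - 4 * w * (2 * h1) + X ^+ 2 * (4 * g2)
  + 4 * X * (2 * g1) - X ^+ 2 * (X ^+ 2 * (4 * g2) + 8 * X * (2 * g1) + 8 * g)); first by ring.
rewrite e1 e2 f1 f2 g3 [in 8 * g]gE /D /D1 /D2 /E1 /E2 /kernel_poly.
ring.
Qed.

Lemma rmorph_ode_coefs (T' : comNzRingType) (f : {rmorphism T -> T'}) y X :
  [/\ f (ode2 y X) = ode2 (f y) (f X), f (ode1 y X) = ode1 (f y) (f X)
    & f (ode0 y X) = ode0 (f y) (f X)].
Proof.
by rewrite /ode2 /ode1 /ode0; split;
  rewrite !(rmorphXn, rmorph_nat, rmorph1, rmorphB, rmorphN, rmorphD, rmorphM).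
Qed.

(** Telescoping in w: up to the factor 4, the right-hand side is S F' + (w - y^2) F with F = [cert]
    g^3 and S = w^2 - 2y^2 w + 2y^2 - 1, the shape that [diag] kills. *)
Lemma cert_id y w X g g1 g2 h1 (D := kernel_poly y w X)
    (D1 := 2 * X * (y ^+ 2 + w ^+ 2 - 1) - 2 * y * w) (D2 := 2 * (y ^+ 2 + w ^+ 2 - 1))
    (E1 := 2 * w * X ^+ 2 - 2 * y * X) :
  D * g ^+ 2 = 1 ->
  2 * g1 = - g ^+ 3 * D1 -> 4 * g2 = 3 * g ^+ 5 * D1 ^+ 2 - 2 * g ^+ 3 * D2 ->
  2 * h1 = - g ^+ 3 * E1 ->
  4 * (ode2 y X * g2 + ode1 y X * g1 + ode0 y X * g) =
  4 * ((w ^+ 2 - 2 * y ^+ 2 * w + 2 * y ^+ 2 - 1)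
       * (dcert y w X * g ^+ 3 + cert y w X * (3 * g ^+ 2 * h1))
    + (w - y ^+ 2) * (cert y w X * g ^+ 3)).
Proof.
move=> Dg e1 e2 f1.
have g3 : g ^+ 3 = D * g ^+ 5 by rewrite -[LHS]mul1r -Dg; ring.
have gE : g = D ^+ 2 * g ^+ 5 by rewrite -[LHS]mul1r -(expr1n T 2) -Dg; ring.
transitivity (ode2 y X * (4 * g2) + 2 * ode1 y X * (2 * g1) + 4 * ode0 y X * g); first by ring.
transitivity (4 * (w ^+ 2 - 2 * y ^+ 2 * w + 2 * y ^+ 2 - 1) * dcert y w X * g ^+ 3
   + 6 * (w ^+ 2 - 2 * y ^+ 2 * w + 2 * y ^+ 2 - 1) * cert y w X * (g ^+ 2 * (2 * h1))
    + 4 * (w - y ^+ 2) * cert y w X * g ^+ 3); last by ring.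
have -> : g ^+ 2 * (2 * h1) = - g ^+ 5 * E1 by rewrite f1; ring.
rewrite e1 e2 g3 [in 4 * ode0 y X * g]gE.
rewrite /D /D1 /D2 /E1 /kernel_poly /ode2 /ode1 /ode0 /cert /dcert.
ring.
Qed.

(** With u, v, t for f(z), f'(z), f''(z), the last hypothesis is the equation of 2F1(1/4, 3/4; 1;
    z). It eliminates t, after which the coefficients of u and v vanish separately. *)
Lemma hyp_ode_id y X g g1 g2 u v t (p := scaled_p y X) (p1 := scaled_p1 y X) (p2 := scaled_p2 y)
    (q := scaled_q y X) (m := wronsk y X) (m1 := wronsk1 y X)
    (z := q * g ^+ 4) (z1 := m * g ^+ 6) (z2 := m1 * g ^+ 6 - 3 * p1 * m * g ^+ 8) :
  p * g ^+ 2 = 1 ->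
  2 * g1 = - g ^+ 3 * p1 -> 4 * g2 = 3 * g ^+ 5 * p1 ^+ 2 - 2 * g ^+ 3 * p2 ->
  16 * (z * (1 - z) * t + (1 - 2 * z) * v) = 3 * u ->
  4 * (ode2 y X * (g2 * u + 2 * g1 * z1 * v + g * (z2 * v + z1 ^+ 2 * t))
       + ode1 y X * (g1 * u + g * z1 * v) + ode0 y X * (g * u)) = 0.
Proof.
move=> pg e1 e2 ode.
(* [E] is the quotient of [ode2] m^2 by 16 q (p^2 - q): since z(1 - z) = q(p^2 - q)g^8, the term in
   t becomes a multiple of z(1 - z)t. *)
pose E := (y ^+ 2 - 1) ^+ 3 * X * (1 - y * X) ^+ 2 * (1 + 2 * y * X) ^+ 3.
have g3 : g ^+ 3 = p * g ^+ 5 by rewrite -[LHS]mul1r -pg; ring.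
have gE : g = p ^+ 2 * g ^+ 5 by rewrite -[LHS]mul1r -(expr1n T 2) -pg; ring.
have g7 : g ^+ 7 = p * g ^+ 9 by rewrite -[LHS]mul1r -pg; ring.
have tE : ode2 y X * m ^+ 2 = 16 * E * q * (p ^+ 2 - q).
  by rewrite /ode2 /m /E /q /p /scaled_p /scaled_q /wronsk; ring.
have uE : ode2 y X * (3 * p1 ^+ 2 - 2 * p * p2) - 2 * ode1 y X * p * p1
    + 4 * ode0 y X * p ^+ 2 + 12 * E = 0.
  by rewrite /ode2 /ode1 /ode0 /E /p /p1 /p2 /scaled_p /scaled_p1 /scaled_p2; ring.
have vE : ode2 y X * (p * m1 - 4 * p1 * m) + ode1 y X * p * m - 16 * E * (p ^+ 2 - 2 * q) = 0.
  by rewrite /ode2 /ode1 /m /m1 /E /q /p /p1 /scaled_p /scaled_p1 /scaled_q /wronsk /wronsk1; ring.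
transitivity ((ode2 y X * (4 * g2) + 2 * ode1 y X * (2 * g1) + 4 * ode0 y X * g) * u
  + 4 * (ode2 y X * ((2 * g1) * z1 + g * z2) + ode1 y X * (g * z1)) * v
  + 4 * (ode2 y X * m ^+ 2) * g ^+ 13 * t); first by rewrite /z1; ring.
rewrite e1 e2 [in 4 * ode0 y X * g]gE g3.
have -> : - (p * g ^+ 5) * p1 * z1 + g * z2 = g ^+ 9 * (p * m1 - 4 * p1 * m).
  transitivity (- (p * g ^+ 11) * p1 * m + m1 * g ^+ 7 - 3 * p1 * m * g ^+ 9).
    by rewrite /z1 /z2; ring.
  have -> : p * g ^+ 11 = g ^+ 9 by rewrite -[RHS]mul1r -pg; ring.
  by rewrite g7; ring.
have -> : g * z1 = g ^+ 9 * (p * m).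
  by transitivity (m * g ^+ 7); [rewrite /z1; ring | rewrite g7; ring].
have ->: 4 * (ode2 y X * m ^+ 2) * g ^+ 13 * t = 4 * E * g ^+ 5 * (16 * (z * (1 - z) * t)).
  rewrite tE /z.
  have <- : p ^+ 2 * g ^+ 4 = 1 by rewrite -(expr1n T 2) -pg; ring.
  ring.
have -> : 16 * (z * (1 - z) * t) = 3 * u - 16 * (1 - 2 * z) * v by rewrite -ode; ring.
have -> : 1 - 2 * z = g ^+ 4 * (p ^+ 2 - 2 * q).
  have <- : p ^+ 2 * g ^+ 4 = 1 by rewrite -(expr1n T 2) -pg; ring.
  by rewrite /z; ring.
transitivity (g ^+ 5 * u * (ode2 y X * (3 * p1 ^+ 2 - 2 * p * p2) - 2 * ode1 y X * p * p1
      + 4 * ode0 y X * p ^+ 2 + 12 * E)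
  + 4 * g ^+ 9 * v * (ode2 y X * (p * m1 - 4 * p1 * m) + ode1 y X * p * m
      - 16 * E * (p ^+ 2 - 2 * q))).
  by ring.
by rewrite uE vE !mulr0 addr0.
Qed.

End Certificates.

(** * Coefficient maps, derivation, scaling and substitution of power series *)

Definition fps_map (A B : Type) (f : A -> B) (F : {fps A}) : {fps B} := FPS (f \o F).

Section MapAdd.
Variables (A B : comNzRingType) (f : {additive A -> B}).
Fact fps_map_additive : zmod_morphism (fps_map f).
Proof. by move=> F G; apply/fpsP => n /=; rewrite -raddfB. Qed.
HB.instance Definition _ := GRing.isZmodMorphism.Build _ _ (fps_map f) fps_map_additive.
Lemma fps_mapC c : fps_map f c%:S = (f c)%:S.
Proof. by apply/fpsP => n /=; case: eqP; rewrite ?raddf0. Qed.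
End MapAdd.

Section MapMul.
Variables (A B : comNzRingType) (f : {rmorphism A -> B}).
Fact fps_map_multiplicative : monoid_morphism (fps_map f).
Proof.
split; first by apply/fpsP => -[|n]; rewrite /= ?rmorph1 ?rmorph0.
move=> F G; apply/fpsP => n /=; rewrite rmorph_sum.
by apply: eq_bigr => i _; rewrite rmorphM.
Qed.
HB.instance Definition _ := GRing.isMonoidMorphism.Build _ _ (fps_map f) fps_map_multiplicative.
Lemma fps_mapX : fps_map f fpsX = fpsX.
Proof. by apply/fpsP => n /=; rewrite rmorph_nat. Qed.
End MapMul.

Section Ring.
Variable R : comNzRingType.
Implicit Types (f g h : {fps R}) (c : R).

Fact fpsC_additive : zmod_morphism (@fpsC R).
Proof. by move=> a b; apply/fpsP => -[|n] /=; rewrite ?subrr. Qed.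
HB.instance Definition _ := GRing.isZmodMorphism.Build _ _ (@fpsC R) fpsC_additive.

Lemma coef_fpsCM c f n : (c%:S * f) n = c * f n.
Proof.
rewrite fps_coefM big_ord_recl /= subn0 big1 ?addr0 // => i _.
by rewrite mul0r.
Qed.

Fact fpsC_multiplicative : monoid_morphism (@fpsC R).
Proof.
split=> // a b; apply/fpsP => n.
by rewrite coef_fpsCM /=; case: eqP => // _; rewrite mulr0.
Qed.
HB.instance Definition _ := GRing.isMonoidMorphism.Build _ _ (@fpsC R) fpsC_multiplicative.

Lemma coef_fpsXM f n : (fpsX * f) n = if n is n'.+1 then f n' else 0.
Proof.
case: n => [|n]; rewrite fps_coefM big_ord_recl /= mul0r ?big_ord0 add0r //.
rewrite big_ord_recl /= mul1r subSS subn0 big1 ?addr0 // => i _.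
by rewrite mul0r.
Qed.

Definition fps_deriv f : {fps R} := FPS (fun n => f n.+1 *+ n.+1).

Fact fps_deriv_additive : zmod_morphism fps_deriv.
Proof. by move=> f g; apply/fpsP => n /=; rewrite -mulrnBl. Qed.
HB.instance Definition _ := GRing.isZmodMorphism.Build _ _ fps_deriv fps_deriv_additive.

Lemma fps_trunc_deriv m f : fps_trunc m (fps_deriv f) = (fps_trunc m.+1 f)^`().
Proof.
by apply/polyP => i; rewrite coef_deriv !coef_poly !ltnS; case: ifP => // _; rewrite mul0rn.
Qed.

Lemma coef_truncM m f g n : (n <= m)%N -> (f * g) n = (fps_trunc m f * fps_trunc m g)`_n.
Proof. exact: fps_mul_trunc. Qed.

(** Coefficient n of the derivative reads coefficient n + 1 of the product, so truncating at n + 1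
    reduces the rule to the one for polynomials. *)
Lemma fps_derivM f g : fps_deriv (f * g) = fps_deriv f * g + f * fps_deriv g.
Proof.
apply/fpsP => n; rewrite fps_coefD.
transitivity ((f * g) n.+1 *+ n.+1) => //.
rewrite (@coef_truncM n.+1) // -coef_deriv derivM coefD.
congr (_ + _).
  rewrite -fps_trunc_deriv coefM fps_coefM; apply: eq_bigr => i _.
  by rewrite !coef_fps_trunc // ?(leq_trans (leq_subr _ _)) // -ltnS.
rewrite -fps_trunc_deriv coefM fps_coefM; apply: eq_bigr => i _.
by rewrite !coef_fps_trunc // ?leq_subr // ltnW.
Qed.

Lemma fps_derivC c : fps_deriv c%:S = 0.
Proof. by apply/fpsP => n /=; rewrite mul0rn if_same. Qed.
Lemma fps_derivX : fps_deriv fpsX = 1.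
Proof. by apply/fpsP => -[|n] //=; rewrite mul0rn. Qed.

Lemma fps_derivXn f n : fps_deriv (f ^+ n) = f ^+ n.-1 * fps_deriv f *+ n.
Proof.
elim: n => [|n IHn]; first by rewrite fps_derivC.
rewrite exprS fps_derivM IHn mulrnAr mulrA -exprS mulrC.
by case: n {IHn} => [|n]; rewrite ?mulr0n ?addr0 // mulrS.
Qed.

(** The substitution of cX for X, used with c = 2 to form H(2X) and with c = t/2 to turn (1 -
    4x)^(-1/2) into (1 - 2tX)^(-1/2). *)
Definition fps_scale c f : {fps R} := FPS (fun n => c ^+ n * f n).

Fact fps_scale_additive c : zmod_morphism (fps_scale c).
Proof. by move=> f g; apply/fpsP => n /=; rewrite mulrBr. Qed.
HB.instance Definition _ c :=
  GRing.isZmodMorphism.Build _ _ (fps_scale c) (fps_scale_additive c).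
Fact fps_scale_multiplicative c : monoid_morphism (fps_scale c).
Proof.
split; first by apply/fpsP => -[|n] /=; rewrite ?expr0 ?mulr1 ?mulr0.
move=> f g; apply/fpsP => n /=; rewrite mulr_sumr; apply: eq_bigr => -[i le_in] _ /=.
by rewrite mulrACA -exprD subnKC.
Qed.
HB.instance Definition _ c :=
  GRing.isMonoidMorphism.Build _ _ (fps_scale c) (fps_scale_multiplicative c).

Lemma fps_scaleC c a : fps_scale c a%:S = a%:S.
Proof. by apply/fpsP => -[|n] /=; rewrite ?expr0 ?mul1r ?mulr0. Qed.
Lemma fps_scaleX c : fps_scale c fpsX = c%:S * fpsX.
Proof. by apply/fpsP => n; rewrite coef_fpsCM /=; case: n => [|[|n]] //=; rewrite !mulr0. Qed.

Section Comp.
Variable g : {fps R}.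
Hypothesis g0 : g 0%N = 0.

Lemma coef_comp_widen f m n : (n <= m)%N ->
  (f \oS g) n = \sum_(k < m.+1) f k * (g ^+ k) n.
Proof.
move=> le_nm; rewrite /fps_comp /= -!(big_mkord xpredT (fun k => f k * (g ^+ k) n)).
rewrite [RHS](@big_cat_nat _ _ _ n.+1) //= [X in _ = _ + X]big1_seq ?addr0 // => k /=.
rewrite mem_index_iota => /andP[lt_nk _].
by rewrite fps_exp_low ?mulr0.
Qed.

Lemma fps_coef_sum (I : Type) (r : seq I) (F : I -> {fps R}) n :
  (\sum_(i <- r) F i) n = \sum_(i <- r) (F i) n.
Proof. by apply: (big_morph (fun h : {fps R} => h n)) => //; rewrite fps_coef0. Qed.

Lemma coef_horner_fpsC (p : {poly R}) m n : (size p <= m)%N ->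
  (map_poly (@fpsC R) p).[g] n = \sum_(i < m) p`_i * (g ^+ i) n.
Proof.
move=> le_pm; rewrite (@horner_coef_wide _ m); last first.
  exact: leq_trans (size_poly _ _) le_pm.
rewrite fps_coef_sum; apply: eq_bigr => i _.
by rewrite coef_map coef_fpsCM.
Qed.

Lemma coef_comp_trunc f m n : (n <= m)%N ->
  (f \oS g) n = (map_poly (@fpsC R) (fps_trunc m f)).[g] n.
Proof.
move=> le_nm; rewrite (coef_comp_widen f le_nm).
rewrite (@coef_horner_fpsC _ m.+1) ?size_poly //.
by apply: eq_bigr => i _; rewrite coef_fps_trunc // -ltnS.
Qed.

Lemma coef_horner_low (p q : {poly R}) n :
  (forall k, (k <= n)%N -> p`_k = q`_k) ->
  (map_poly (@fpsC R) p).[g] n = (map_poly (@fpsC R) q).[g] n.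
Proof.
move=> pq; rewrite (coef_horner_fpsC _ (leq_maxl _ (size q))).
rewrite (coef_horner_fpsC _ (leq_maxr (size p) _)); apply: eq_bigr => i _.
have [le_in|lt_ni] := leqP i n; first by rewrite pq.
by rewrite fps_exp_low // !mulr0.
Qed.

(** Coefficient n of a substitution is that of a truncated polynomial evaluated at g, and evaluation
    is multiplicative. Terms of degree above n in the product of truncations contribute nothing,
    since g has no constant term. *)
Lemma fps_compM f h : (f * h) \oS g = (f \oS g) * (h \oS g).
Proof.
apply/fpsP => n; rewrite (@coef_comp_trunc _ n) //.
transitivity ((map_poly (@fpsC R) (fps_trunc n f * fps_trunc n h)).[g] n).
  apply: coef_horner_low => k le_kn.
  by rewrite coef_fps_trunc // (coef_truncM _ _ le_kn).
rewrite rmorphM hornerM !fps_coefM; apply: eq_bigr => i _.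
by rewrite -!coef_comp_trunc ?leq_subr // -ltnS.
Qed.

Lemma fps_compD f h : (f + h) \oS g = (f \oS g) + (h \oS g).
Proof. by apply/fpsP => n /=; rewrite -big_split; apply: eq_bigr => i _; rewrite mulrDl. Qed.

Lemma fps_compN f : (- f) \oS g = - (f \oS g).
Proof. by apply/fpsP => n /=; rewrite -sumrN; apply: eq_bigr => i _; rewrite mulNr. Qed.

Lemma fps_compC c : c%:S \oS g = c%:S.
Proof.
apply/fpsP => n /=; rewrite big_ord_recl /= big1 => [|i _]; last by rewrite mul0r.
by rewrite addr0; case: n => [|n] /=; rewrite ?mulr1 ?mulr0.
Qed.

Lemma fps_compX : fpsX \oS g = g.
Proof.
apply/fpsP => -[|n]; first by rewrite (@coef_comp_widen _ 0) // big_ord1 /= mul0r.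
rewrite /= 2!big_ord_recl /= big1 => [|i _]; last by rewrite mul0r.
by rewrite mul0r add0r addr0 mul1r.
Qed.

Lemma fps_comp0 f : (f \oS g) 0%N = f 0%N.
Proof. by rewrite /= big_ord1 expr0 /= mulr1. Qed.

Lemma fps_deriv_comp f : fps_deriv (f \oS g) = (fps_deriv f \oS g) * fps_deriv g.
Proof.
apply/fpsP => n; transitivity ((f \oS g) n.+1 *+ n.+1) => //.
have -> : (f \oS g) n.+1 = \sum_(k < n.+1) f k.+1 * (g ^+ k.+1) n.+1.
  by rewrite [LHS]/= big_ord_recl /= mulr0 add0r.
rewrite -mulr_natl mulr_sumr.
transitivity (\sum_(k < n.+1) (fps_deriv f k) * (g ^+ k * fps_deriv g) n).
  apply: eq_bigr => k _; have := congr1 (fun h : {fps R} => h n) (fps_derivXn g k.+1).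
  rewrite fps_coefMn [LHS]/= => E; rewrite mulr_natl -mulrnAr E.
  by rewrite mulrnAr mulrnAl.
rewrite fps_coefM.
transitivity (\sum_(i < n.+1) \sum_(k < n.+1)
    fps_deriv f k * ((g ^+ k) i * fps_deriv g (n - i)%N)).
  by rewrite exchange_big; apply: eq_bigr => k _; rewrite fps_coefM mulr_sumr.
apply: eq_bigr => i _; rewrite (@coef_comp_widen _ n) -1?ltnS // mulr_suml.
by apply: eq_bigr => k _; rewrite mulrA.
Qed.
End Comp.
End Ring.

(** * Linear maps given by their values on monomials *)

Section Umbral.
Variables (R : comNzRingType) (V : lmodType R).

Definition umbral (u : nat -> V) (p : {poly R}) : V := \sum_(i < size p) p`_i *: u i.

Lemma umbral_wide u (p : {poly R}) n : (size p <= n)%N -> umbral u p = \sum_(i < n) p`_i *: u i.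
Proof.
move=> le_pn; rewrite /umbral -!(big_mkord xpredT (fun i => p`_i *: u i)).
rewrite [RHS](@big_cat_nat _ _ _ (size p)) //= [X in _ = _ + X]big1_seq ?addr0 // => i /=.
by rewrite mem_index_iota => /andP[le_pi _]; rewrite nth_default ?scale0r.
Qed.

Fact umbral_linear u : linear (umbral u).
Proof.
move=> a p q; pose n := maxn (size p) (size q).
have le_pn : (size p <= n)%N by apply: leq_maxl.
have le_qn : (size q <= n)%N by apply: leq_maxr.
have le_n : (size (a *: p + q)%R <= n)%N.
  rewrite (leq_trans (size_polyD _ _)) // geq_max le_qn andbT.
  exact: leq_trans (size_scale_leq _ _) le_pn.
rewrite (umbral_wide _ le_pn) (umbral_wide _ le_qn) (umbral_wide _ le_n).
rewrite scaler_sumr -big_split; apply: eq_bigr => i _ /=.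
by rewrite coefD coefZ scalerDl scalerA.
Qed.
HB.instance Definition _ u := GRing.isLinear.Build _ _ _ _ (umbral u) (umbral_linear u).

Lemma umbralXn u n : umbral u 'X^n = u n.
Proof.
rewrite (@umbral_wide _ _ n.+1) ?size_polyXn // (bigD1 ord_max) //= big1.
  by rewrite coefXn eqxx scale1r addr0.
by move=> i ne_in; rewrite coefXn (_ : (i == n :> nat) = false) ?scale0r //; apply: negbTE.
Qed.

Lemma linear_polyP (f g : {linear {poly R} -> V}) :
  (forall n, f 'X^n = g 'X^n) -> f =1 g.
Proof.
move=> fg p; rewrite -[p]coefK poly_def !linear_sum; apply: eq_bigr => i _.
by rewrite !linearZ /= fg.
Qed.
End Umbral.

(** * The Legendre operator and the Legendre polynomials *)

Section LegendreOperator.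
Variable R : comNzRingType.
Implicit Types f g p : {poly R}.

Definition legop f := (1 - 'X^2) * f^`()^`() - 2 * 'X * f^`().

Fact legop_linear : linear legop.
Proof. by move=> a f g; rewrite /legop !linearP /= -!mul_polyC; ring. Qed.
HB.instance Definition _ := GRing.isLinear.Build _ _ _ _ legop legop_linear.

Lemma legopXn n :
  legop 'X^n = (n * n.-1)%:R *: 'X^(n.-2) - (n * n.+1)%:R *: 'X^n.
Proof.
rewrite /legop derivXn derivMn derivXn -mulrnA !mulrnAr.
rewrite -!mul_polyC !polyC_natr.
by case: n => [|[|n]] /=; rewrite ?exprS; ring.
Qed.

Lemma deriv_natr n : (n%:R : {poly R})^`() = 0.
Proof. by rewrite -polyC_natr derivC. Qed.

(* derivXn comes first: derivM would also match 'X^n, up to unfolding of the power. *)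
Let dE := (derivXn, derivX, derivC, deriv_natr, derivN, derivD, derivM).

Lemma legop_derivn f a j : legop f = a *: f ->
  (1 - 'X^2) * f^`(j.+2) - (2 * j.+1)%:R * 'X * f^`(j.+1) =
  (a + (j * j.+1)%:R)%:P * f^`(j).
Proof.
move=> fE; elim: j => [|j IHj].
  by rewrite /= muln1 mul0n addr0 mul_polyC -fE.
have := congr1 (fun p => p^`()) IHj.
rewrite !dE -!derivnS.
set f1 := f^`(j.+1); set f2 := f^`(j.+2); set f3 := f^`(j.+3).
rewrite !(polyCD, polyC_natr) => E.
transitivity ((0 - 'X *+ 2) * f2 + (1 - 'X^2) * f3 -
  ((0 * 'X + (2 * j.+1)%:R * 1) * f1 + (2 * j.+1)%:R * 'X * f2) + (2 * j.+1)%:R * f1).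
  by ring.
rewrite E; ring.
Qed.

(** The relation (X^2 - 1)v' = 2nXv differentiated j + 1 times. For j = n it is the Legendre
    equation of v^(n). *)
Lemma rodrigues_derivn n j (v := ('X^2 - 1 : {poly R}) ^+ n) :
  ('X^2 - 1) * v^`(j.+2) + 2 * (j.+1%:R - n%:R) * 'X * v^`(j.+1)
  + (j.+1 * j)%:R * v^`(j) - (2 * n * j.+1)%:R * v^`(j) = 0.
Proof.
elim: j => [|j IHj].
  have E : ('X^2 - 1) * v^`() = (2 * n)%:R * 'X * v.
    rewrite /v deriv_exp !dE; case: n {v} => [|n] /=.
      by rewrite !mulr0n; ring.
    by rewrite [_ ^+ n.+1]exprS; ring.
  have := congr1 (fun p => p^`()) E.
  rewrite !dE derivnS derivn1 derivn0 expr1 => {}E.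
  transitivity (('X *+ 2 - 0) * v^`() + ('X^2 - 1) * v^`()^`()
    - ((0 * 'X + (2 * n)%:R * 1) * v + (2 * n)%:R * 'X * v^`())); first by ring.
  by rewrite E subrr.
have := congr1 (fun p => p^`()) IHj; rewrite [RHS]deriv0.
have -> : 2 * (j.+1%:R - n%:R) = (2 * (j.+1%:R - n%:R))%:P :> {poly R}.
  by rewrite polyCM polyCB !polyC_natr.
rewrite !dE -!derivnS expr1 !polyCM polyCB !polyC_natr.
set v1 := v^`(j.+1); set v2 := v^`(j.+2); set v3 := v^`(j.+3) => E.
rewrite -[RHS]E; ring.
Qed.

(** Only the term with all n derivatives on (X - 1)^n survives at 1. With g = (X + 1)^n this gives
    P_n(1) = 1. *)
Lemma derivn_root_exp n g : (('X - 1) ^+ n * g)^`(n).[1] = n`!%:R * g.[1].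
Proof.
elim: n g => [|n IHn] g; first by rewrite mul1r mul1r.
rewrite derivSn.
have -> : (('X - 1) ^+ n.+1 * g)^`() = ('X - 1) ^+ n * (n.+1%:R * g + ('X - 1) * g^`()).
  rewrite derivM deriv_exp !dE [_ ^+ n.+1]exprS; ring.
by rewrite IHn hornerD !hornerM -polyC_natr !hornerE factS natrM; ring.
Qed.

End LegendreOperator.

(* Differentiating j times and evaluating at 1 expresses f^(j+1)(1) through f^(j)(1). *)
Lemma legop_eigen_unique (R : idomainType) (f : {poly R}) (a : R) :
  (forall n, n.+1%:R != 0 :> R) -> legop f = a *: f -> f.[1] = 0 -> f = 0.
Proof.
move=> ch0 fE f1.
have d0 j : f^`(j).[1] = 0.
  elim: j => [|j IHj] //; have := congr1 (fun p => p.[1]) (legop_derivn j fE).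
  rewrite !hornerM hornerD hornerN !hornerM !hornerD hornerN hornerXn hornerX.
  rewrite -polyC_natr !hornerC IHj expr1n subrr mul0r mulr0 mulr1 sub0r.
  by move/eqP; rewrite oppr_eq0 mulf_eq0 mulnS (negbTE (ch0 _)) => /eqP.
(* All derivatives of f vanish at 1, but the one of order n = deg f is the constant n! times the
   leading coefficient. *)
apply/eqP/contraT => nz_f; pose n := (size f).-1.
have size_f : size f = n.+1 by rewrite prednK // size_poly_gt0.
have fn_const : f^`(n) = (f^`(n)`_0)%:P.
  apply: size1_polyC; apply/leq_sizeP => j lt0j.
  by rewrite coef_derivn nth_default ?mul0rn // size_f -addn1 leq_add2l.
have := d0 n; rewrite fn_const hornerC coef_derivn addn0 ffactnn => /eqP.
rewrite -mulr_natr mulf_eq0 -lead_coefE lead_coef_eq0 (negbTE nz_f) /=.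
by rewrite -(prednK (fact_gt0 n)) (negbTE (ch0 _)).
Qed.

Lemma legop_legendre n : legop (legendre n) = - (n * n.+1)%:R *: legendre n.
Proof.
rewrite /legendre linearZ /= [RHS]scalerA [_ * (_ * _)^-1]mulrC -scalerA; congr (_ *: _).
pose v : {poly rat} := ('X^2 - 1) ^+ n; rewrite -/v.
have := rodrigues_derivn rat n n; rewrite -/v => E.
rewrite -mul_polyC rmorphN /= polyC_natr /legop -!derivnS.
set v0 := v^`(n) in E *; set v1 := v^`(n.+1) in E *; set v2 := v^`(n.+2) in E *.
have {}E := congr1 -%R E; rewrite oppr0 in E.
apply/eqP; rewrite -subr_eq0 -[X in _ == X]E; apply/eqP; ring.
Qed.

Lemma legendre1 n : (legendre n).[1] = 1.
Proof.
rewrite /legendre hornerZ.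
have -> : ('X^2 - 1 : {poly rat}) ^+ n = ('X - 1) ^+ n * ('X + 1) ^+ n.
  by rewrite -exprMn; congr (_ ^+ n); ring.
rewrite derivn_root_exp horner_exp hornerD hornerX hornerC -[1 + 1]/(2%:R : rat).
rewrite [n`!%:R * _]mulrC mulVf // mulf_neq0 ?expf_neq0 ?pnatr_eq0 //.
by rewrite -lt0n fact_gt0.
Qed.

(** * Inverse square roots of power series *)

Section InverseSqrt.
Variable R : comUnitRingType.
Hypothesis U2 : (2 : R) \is a GRing.unit.
Implicit Types D a b : {fps R}.

Lemma fps_rsqrtP D : D 0%N = 1 ->
  ((fps_sqrt D)^-1) 0%N = 1 /\ D * ((fps_sqrt D)^-1) ^+ 2 = 1.
Proof.
move=> D0; have [s0 s2] := fps_sqrtP U2 D0.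
have Us : fps_sqrt D \is a GRing.unit by rewrite fps_unitE s0 unitr1.
split; last by rewrite -{1}s2 exprVn divrr // unitrX.
have := congr1 (fun f : {fps R} => f 0%N) (divrr Us).
by rewrite fps_coef0M s0 mul1r fps_coef1.
Qed.

(** Both squares invert D, so (a - b)(a + b) = 0, and a + b is a unit because its constant term is
    2. *)
Lemma fps_rsqrt_unique D a b : a 0%N = 1 -> b 0%N = 1 ->
  D * a ^+ 2 = 1 -> D * b ^+ 2 = 1 -> a = b.
Proof.
move=> a0 b0 Da Db; apply/eqP; rewrite -subr_eq0; apply/eqP.
have Uab : a + b \is a GRing.unit by rewrite fps_unitE fps_coefD a0 b0.
apply: (mulIr Uab); rewrite mul0r -subr_sqr.
by rewrite -[LHS]mul1r -{1}Da mulrAC mulrBr Da Db subrr mul0r.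
Qed.
End InverseSqrt.

Lemma natr_unit_fps (R : comUnitRingType) n :
  (n%:R : R) \is a GRing.unit -> (n%:R : {fps R}) \is a GRing.unit.
Proof. by move=> Un; rewrite -(rmorph_nat (@fpsC R)) rmorph_unit. Qed.

Section Coef.
Variable R : comNzRingType.
Implicit Type F : {fps R}.

Lemma coef_fpsX2M F n : (fpsX ^+ 2 * F) n = if n is n'.+2 then F n' else 0.
Proof. by rewrite expr2 -mulrA coef_fpsXM; case: n => [|n] //; rewrite coef_fpsXM. Qed.

Lemma coef_fps_theta F n : (fpsX * fps_deriv F) n = F n *+ n.
Proof. by rewrite coef_fpsXM; case: n. Qed.

Lemma coef_fps_theta2 F n : (fpsX ^+ 2 * fps_deriv (fps_deriv F)) n = F n *+ (n * n.-1).
Proof. by rewrite coef_fpsX2M; case: n => [|[|n]]; rewrite ?muln0 // mulrnA. Qed.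
End Coef.

Lemma fps_map_derivM (R : comNzRingType) (F G : {fps {poly R}}) :
  fps_map (@deriv R) (F * G) = fps_map (@deriv R) F * G + F * fps_map (@deriv R) G.
Proof.
apply/fpsP => n; rewrite fps_coefD !fps_coefM -big_split /= raddf_sum.
by apply: eq_bigr => i _; rewrite /= derivM.
Qed.

Lemma fps_map_derivC (R : comNzRingType) (p : {poly R}) :
  fps_map (@deriv R) p%:S = (p^`())%:S.
Proof. exact: fps_mapC. Qed.

Lemma fps_map_deriv_fpsX (R : comNzRingType) : fps_map (@deriv R) fpsX = 0.
Proof. by apply/fpsP => n /=; rewrite -polyC_natr derivC if_same. Qed.

Lemma fps_map_kernel_poly (A B : comNzRingType) (f : {rmorphism A -> B}) a b :
  fps_map f (kernel_poly a%:S b%:S fpsX) = kernel_poly (f a)%:S (f b)%:S fpsX.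
Proof.
by rewrite (rmorph_kernel_poly (fps_map f)) -(fps_mapC f a) -(fps_mapC f b) -(fps_mapX f).
Qed.

Section CstLinear.
Variables (R : comNzRingType) (f : {linear {poly R} -> R^o}).
Implicit Types (a z : {fps R}) (F : {fps {poly R}}).

(** Moves a functional acting on coefficients past series in X that are constant in the polynomial
    variable. *)
Lemma fps_map_cstM_linear a F : fps_map f (fps_map (@polyC R) a * F) = a * fps_map f F.
Proof.
apply/fpsP => n; rewrite fps_coefM /= raddf_sum; apply: eq_bigr => i _.
by rewrite /= mul_polyC linearZ.
Qed.

Lemma fps_map_comp_linear F z : fps_map f (F \oS fps_map (@polyC R) z) = fps_map f F \oS z.
Proof.
apply/fpsP => n; rewrite /= raddf_sum; apply: eq_bigr => i _.
by rewrite -rmorphXn /= mulrC mul_polyC linearZ /= mulrC.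
Qed.
End CstLinear.

(** * The kernel, the product formula and the diagonal functional *)

Section Kernel.
Variables (R : idomainType) (y : R).
Hypothesis natU : forall n, (n.+1%:R : R) \is a GRing.unit.
Local Notation T := {poly R}.
Local Notation S := {fps {poly R}}.

Lemma poly_natU n : (n.+1%:R : T) \is a GRing.unit.
Proof. by rewrite -polyC_natr rmorph_unit. Qed.
Lemma fps_poly_natU n : (n.+1%:R : S) \is a GRing.unit.
Proof. exact/natr_unit_fps/poly_natU. Qed.

(* Formally, kernel n is the average of (y w + sqrt((1 - y^2)(1 - w^2)) cos t)^n over t. *)
Definition kernel_den : S := kernel_poly (y%:P)%:S 'X%:S fpsX.
Definition kernel : S := (fps_sqrt kernel_den)^-1.

Lemma kernelP : kernel 0%N = 1 /\ kernel_den * kernel ^+ 2 = 1.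
Proof.
apply: fps_rsqrtP; first exact: (poly_natU 1).
rewrite /kernel_den /kernel_poly !fps_coefD fps_coefN expr2 !fps_coef0M.
by rewrite /= !mul0r mulr0 subr0 addr0.
Qed.

Local Notation dX := (@fps_deriv T).
Local Notation dw := (fps_map (@deriv R)).
Local Notation yS := (y%:P)%:S.
Local Notation wS := ('X%:S : S).

Lemma kernel_derX : let D1 := 2 * fpsX * (yS ^+ 2 + wS ^+ 2 - 1) - 2 * yS * wS in
  2 * dX kernel = - kernel ^+ 3 * D1 /\
  4 * dX (dX kernel) = 3 * kernel ^+ 5 * D1 ^+ 2
    - 2 * kernel ^+ 3 * (2 * (yS ^+ 2 + wS ^+ 2 - 1)).
Proof.
have [_ Dk] := kernelP.
have [X1 X2] := @der_kernel_poly_X S dX (@fps_derivM _)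
  yS wS fpsX (fps_derivC _) (fps_derivC _) (fps_derivX _).
have g1 := der_rsqrt (@fps_derivM _) Dk.
have g2 := der_rsqrt2 (@fps_derivM _) Dk.
by rewrite -/kernel_den in X1; rewrite X1 in g1; rewrite X1 X2 in g2.
Qed.

Lemma kernel_derw : let E1 := 2 * wS * fpsX ^+ 2 - 2 * yS * fpsX in
  2 * dw kernel = - kernel ^+ 3 * E1 /\
  4 * dw (dw kernel) = 3 * kernel ^+ 5 * E1 ^+ 2 - 2 * kernel ^+ 3 * (2 * fpsX ^+ 2).
Proof.
have [_ Dk] := kernelP.
have dy : dw yS = 0 by rewrite fps_map_derivC derivC.
have dw1 : dw wS = 1 by rewrite fps_map_derivC derivX.
have [W1 W2] := der_kernel_poly_w (@fps_map_derivM _) dy dw1 (fps_map_deriv_fpsX _).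
have h1 := der_rsqrt (@fps_map_derivM _) Dk.
have h2 := der_rsqrt2 (@fps_map_derivM _) Dk.
by rewrite -/kernel_den in W1; rewrite W1 in h1; rewrite W1 W2 in h2.
Qed.

Lemma kernel_pde :
  (1 - 'X^2)%:S * dw (dw kernel) - (2 * 'X)%:S * dw kernel
  + (fpsX ^+ 2 * dX (dX kernel) + (fpsX * dX kernel) *+ 2) =
  fpsX ^+ 2 * (fpsX ^+ 2 * dX (dX kernel) + (fpsX * dX kernel) *+ 4 + kernel *+ 2).
Proof.
have [_ Dk] := kernelP; have [g1 g2] := kernel_derX; have [h1 h2] := kernel_derw.
have := kernel_pde_id Dk g1 g2 h1 h2.
rewrite rmorphB rmorph1 rmorphXn rmorphM rmorph_nat.
set k2 := dX (dX kernel); set k1 := dX kernel; set l1 := dw kernel; set l2 := dw l1.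
move=> E; apply: (mulrI (fps_poly_natU 3)); apply/eqP; rewrite -subr_eq0 -[X in _ == X]E.
by apply/eqP; ring.
Qed.

(* The right-hand side is umbral kernel applied to legop 'X^n, by legopXn. *)
Lemma legop_kernel n : legop (kernel n) =
  (n * n.-1)%:R *: kernel n.-2 - (n * n.+1)%:R *: kernel n.
Proof.
have := congr1 (fun f : S => f n) kernel_pde.
rewrite !fps_coefD fps_coefN !coef_fpsCM coef_fps_theta2 !coef_fps_theta.
rewrite -[dw (dw kernel) n]/((kernel n)^`()^`()).
rewrite -[dw kernel n]/((kernel n)^`()) -/(legop (kernel n)).
move/(canRL (addrK _)) => ->; rewrite coef_fpsX2M; set F : S := fpsX ^+ 2 * _ + _ + _.
have FE k : F k = kernel k *+ (k * k.-1) + kernel k *+ k *+ 4 + kernel k *+ 2.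
  by rewrite !fps_coefD coef_fps_theta2 !coef_fps_theta; ring.
(* The default value of n.-2 for n < 2 is harmless, as its factor n(n - 1) is zero there. *)
rewrite -!mul_polyC !polyC_natr; clearbody F; case: n => [|[|n]] /=; first by ring.
  by ring.
by rewrite FE; case: n => [|n] /=; ring.
Qed.

(** The map L_y = [umbral kernel] intertwines the Legendre operators in t and in w; on monomials
    this is [legop_kernel]. Hence it preserves eigenvalues. *)
Lemma legop_umbral p : legop (umbral kernel p) = umbral kernel (legop p).
Proof.
apply: (@linear_polyP R T (@legop R \o umbral kernel) (umbral kernel \o @legop R)) => n.
by rewrite /= umbralXn legop_kernel legopXn linearB !linearZ /= !umbralXn.
Qed.

Lemma kernel_horner c : let e := fps_map (horner_eval c) kernel in
  e 0%N = 1 /\ kernel_poly y%:S c%:S fpsX * e ^+ 2 = 1.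
Proof.
have [k0 Dk] := kernelP; split; first by rewrite /= k0 rmorph1.
have E : fps_map (horner_eval c) kernel_den = kernel_poly y%:S c%:S fpsX.
  by apply: etrans (fps_map_kernel_poly _ _ _) _; rewrite /= /horner_eval hornerC hornerX.
by rewrite /= -E -rmorphXn -rmorphM Dk rmorph1.
Qed.

(** At w = 1 the denominator is (1 - yX)^2, so the kernel becomes the geometric series in yX. *)
Lemma kernel_horner1 n : (kernel n).[1] = y ^+ n.
Proof.
have [e0 De] := kernel_horner 1.
pose b : {fps R} := FPS (fun n => y ^+ n).
have bE : (1 - y%:S * fpsX) * b = 1.
  apply/fpsP => -[|m]; rewrite mulrBl mul1r fps_coefD fps_coefN -mulrA coef_fpsCM coef_fpsXM.
    by rewrite mulr0 subr0 /= expr0.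
  by rewrite /= -exprS subrr.
have Db : kernel_poly y%:S 1%:S fpsX * b ^+ 2 = 1.
  transitivity (((1 - y%:S * fpsX) * b) ^+ 2); last by rewrite bE expr1n.
  by rewrite /kernel_poly (_ : (1 : R)%:S = 1) //; ring.
have := fps_rsqrt_unique (natU 1) e0 _ De Db.
by move=> /(_ (expr0 y)) /fpsP/(_ n).
Qed.

Lemma umbral_horner c p :
  (umbral kernel p).[c] = umbral (V := R^o) (fun n => (kernel n).[c]) p.
Proof.
by rewrite /umbral horner_sum; apply: eq_bigr => i _; rewrite hornerZ.
Qed.

Lemma umbral_horner1 p : (umbral kernel p).[1] = p.[y].
Proof.
rewrite umbral_horner /umbral horner_coef; apply: eq_bigr => i _.
by rewrite kernel_horner1.
Qed.

Lemma product_formula p a : legop p = a *: p -> p.[1] = 1 ->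
  umbral kernel p = p.[y] *: p.
Proof.
move=> pE p1; apply/eqP; rewrite -subr_eq0; apply/eqP.
apply: (@legop_eigen_unique R _ a) => [n||].
- by apply: contraTneq (natU n) => ->; rewrite unitr0.
- rewrite linearB linearZ /= legop_umbral pE linearZ /= scalerBr !scalerA.
  by rewrite [a * _]mulrC.
- by rewrite hornerD hornerN hornerZ umbral_horner1 p1 mulr1 subrr.
Qed.

(* Formally, diag f is the average of f(y^2 + (1 - y^2) cos t) over t. *)
Definition diag : {poly R} -> R^o := umbral (V := R^o) (fun n => (kernel n).[y]).
HB.instance Definition _ := GRing.Linear.on diag.
Definition diag_kernel : {fps R} := fps_map diag kernel.

(** The functional is [diag] after L_y. The product formula gives one factor p(y) from L_y p, and
    two more from diag p = (L_y p)(y) = p(y)^2. *)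
Lemma umbral_diag_kernel p a : legop p = a *: p -> p.[1] = 1 ->
  umbral (V := R^o) diag_kernel p = p.[y] ^+ 3.
Proof.
move=> pE p1; have pf := product_formula pE p1.
transitivity (diag (umbral kernel p)).
  apply: (@linear_polyP R R^o (umbral (V := R^o) diag_kernel) (diag \o umbral kernel)) => n.
  by rewrite /= !umbralXn.
rewrite pf linearZ /= /diag -umbral_horner pf hornerZ /GRing.scale /=.
by rewrite !exprS expr0 mulr1.
Qed.

(** At w = y the denominator is D = 1 - 2y^2 X + (2y^2 - 1)X^2, and 2 D E' = -D' E for E = D^(-1/2)
    becomes this recurrence for the moments of [diag]. *)
Lemma diag_rec n : let e k := (kernel k).[y] in
  e n.+1 *+ n.+1 - 2 * y ^+ 2 * (e n *+ n) + (2 * y ^+ 2 - 1) * (e n.-1 *+ n)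
  = y ^+ 2 * e n.
Proof.
move=> e; have [e0 De] := kernel_horner y; set E := fps_map _ _ in e0 De.
have [X1 _] := der_kernel_poly_X (@fps_derivM R) (fps_derivC y) (fps_derivC y) (fps_derivX R).
have := der_rsqrt (@fps_derivM R) De; rewrite X1 /=; set E' := fps_deriv E => d1.
(* The extra factor X expresses the derivative terms through X E', whose coefficient k is k e_k. *)
have ode : fpsX * E' + (2 * y ^+ 2 - 1)%:S * (fpsX * (fpsX * (fpsX * E')))
    - (2 * y ^+ 2)%:S * (fpsX * (fpsX * E')) =
  (y ^+ 2)%:S * (fpsX * E) - (2 * y ^+ 2 - 1)%:S * (fpsX * (fpsX * E)).
  rewrite !(rmorphXn, rmorph_nat, rmorph1, rmorphB, rmorphM) /=.
  set x : {fps R} := fpsX; set z := y%:S.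
  apply: (mulrI (natr_unit_fps (natU 1))).
  transitivity (x * (kernel_poly z z x * (2 * E'))); first by rewrite /kernel_poly; ring.
  rewrite d1 -/x -/z.
  transitivity (- x * (kernel_poly z z x * E ^+ 2)
    * (E * (2 * x * (z ^+ 2 + z ^+ 2 - 1) - 2 * z * z))).
    by ring.
  by rewrite De; ring.
have := congr1 (fun f : {fps R} => f n.+1) ode.
have th k : (fpsX * E') k = e k *+ k by apply: coef_fps_theta.
have Ee k : E k = e k by []; clearbody e.
rewrite !(fps_coefD, fps_coefN) !coef_fpsCM th !(coef_fpsXM _ n.+1) th Ee.
rewrite [(fpsX * (fpsX * E')) _]coef_fpsXM [(fpsX * E) _]coef_fpsXM.
case: n => [|n]; rewrite ?th ?Ee.
  by rewrite !mulr0n !(mulr0, addr0, subr0).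
move=> E1; rewrite -[RHS](subrK ((2 * y ^+ 2 - 1) * e n)) -E1; ring.
Qed.

Fact diag_op_linear : linear (fun p : {poly R} =>
  ('X^2 - (2 * y ^+ 2) *: 'X + (2 * y ^+ 2 - 1)%:P) * p^`() + ('X - (y ^+ 2)%:P) * p).
Proof. by move=> a p q; rewrite !linearP /= -!mul_polyC; ring. Qed.

(** With S = w^2 - 2y^2 w + 2y^2 - 1 the argument is S p' + S' p/2, formally sqrt(S) times the
    derivative of sqrt(S) p, while [diag] integrates against a multiple of 1/sqrt(-S) between the
    roots of S. The proof checks monomials, where the claim is [diag_rec]. *)
Lemma diag_exact p :
  diag (('X^2 - (2 * y ^+ 2) *: 'X + (2 * y ^+ 2 - 1)%:P) * p^`() + ('X - (y ^+ 2)%:P) * p) = 0.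
Proof.
pose op p : {poly R} :=
  ('X^2 - (2 * y ^+ 2) *: 'X + (2 * y ^+ 2 - 1)%:P) * p^`() + ('X - (y ^+ 2)%:P) * p.
pose opL := GRing.isLinear.Build _ _ _ _ op diag_op_linear.
pose opl : {linear {poly R} -> {poly R}} := HB.pack op opL.
rewrite -/(op p) -[p]coefK poly_def.
rewrite -[op]/(opl : _ -> _) !linear_sum big1 // => i _.
rewrite !linearZ /= (_ : diag (op 'X^i) = 0) ?scaler0 //; move: {p i}(i : nat) => n.
have -> : op 'X^n = n%:R *: 'X^(n.+1) - (2 * y ^+ 2 * n%:R) *: 'X^n
   + ((2 * y ^+ 2 - 1) * n%:R) *: 'X^(n.-1) + 'X^(n.+1) - y ^+ 2 *: 'X^n.
  rewrite /op derivXn -!mul_polyC; case: n => [|n] /=.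
    by rewrite !mulr0n !mulr0 ?expr0; ring.
  by rewrite !exprS !(polyCM, polyCB, polyC_natr, polyC1, polyC_exp); ring.
rewrite !(linearB, linearD, linearZ) /= /diag !umbralXn.
have := diag_rec n.
rewrite /GRing.scale /= => /eqP; rewrite -subr_eq0 => /eqP E.
by rewrite -[RHS]E; ring.
Qed.

Lemma fps_deriv_map_diag (F : S) : fps_deriv (fps_map diag F) = fps_map diag (dX F).
Proof. by apply/fpsP => n; rewrite /= raddfMn. Qed.

Lemma fps_map_diag_exact (F : S) :
  fps_map diag (('X^2 - (2 * y ^+ 2) *: 'X + (2 * y ^+ 2 - 1)%:P)%:S * dw F
    + ('X - (y ^+ 2)%:P)%:S * F) = 0.
Proof.
apply/fpsP => n; rewrite fps_coef0 -[RHS](diag_exact (F n)).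
by apply: (congr1 diag); rewrite fps_coefD !coef_fpsCM.
Qed.

(** Since [diag] commutes with d/dX and with multiplication by series constant in w, the operator
    can be applied to [kernel] first; [cert_id] writes the result in the form killed by
    [diag_exact]. *)
Lemma diag_kernel_ode :
  ode2 y%:S fpsX * fps_deriv (fps_deriv diag_kernel) + ode1 y%:S fpsX * fps_deriv diag_kernel
  + ode0 y%:S fpsX * diag_kernel = 0.
Proof.
have [_ Dk] := kernelP; have [g1 g2] := kernel_derX; have [h1 h2] := kernel_derw.
have := cert_id Dk g1 g2 h1.
set c := cert _ _ _; set c' := dcert _ _ _.
have dc : dw c = c'.
  have dy : dw yS = 0 by rewrite fps_map_derivC derivC.
  have dw1 : dw wS = 1 by rewrite fps_map_derivC derivX.
  exact: (der_cert (@fps_map_derivM R) dy dw1 (fps_map_deriv_fpsX R)).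
have dk3 : dw (kernel ^+ 3) = 3 * kernel ^+ 2 * dw kernel by apply: (derX3 (@fps_map_derivM R)).
move=> /(mulrI (fps_poly_natU 3)) E.
rewrite /diag_kernel !fps_deriv_map_diag -!(fps_map_cstM_linear diag) -!raddfD /=.
have [-> -> ->] := rmorph_ode_coefs (fps_map (@polyC R)) y%:S fpsX.
rewrite /= (fps_mapC (@polyC R)) fps_mapX E -dk3 -dc -(fps_map_derivM c).
rewrite -[RHS](fps_map_diag_exact (c * kernel ^+ 3)); congr (fps_map diag (_ * _ + _ * _)).
  rewrite -mul_polyC !(rmorphXn, rmorph_nat, rmorph1, rmorphB, rmorphD, rmorphM) /=.
  by ring.
by rewrite !(rmorphXn, rmorphB).
Qed.
End Kernel.

(** * The differential equation: uniqueness and the hypergeometric solution *)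

Section Ode.
Variables (R : idomainType) (y : R).
Hypothesis natU : forall n, (n.+1%:R : R) \is a GRing.unit.
Local Notation S := {fps R}.
Local Notation d := (@fps_deriv R).
Local Notation yS := (y%:S : S).
Local Notation x := (fpsX : S).

Lemma coef_mul_low (U F : S) n : (forall i, (i < n)%N -> F i = 0) -> (U * F) n = U 0%N * F n.
Proof.
move=> F0; rewrite fps_coefM big_ord_recl /= subn0 big1 ?addr0 // => i _.
by rewrite F0 ?mulr0 // /bump /= ltn_subrL /= (leq_ltn_trans _ (ltn_ord i)).
Qed.

(** As [ode2] is X times a series with constant term 1 and [ode1] has constant term 1, once F_0,
    ..., F_n vanish the coefficient n of the equation reads n(n + 1) F_(n+1) + (n + 1) F_(n+1) = (n
    + 1)^2 F_(n+1) = 0. *)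
Lemma ode_unique (F : S) : F 0%N = 0 ->
  ode2 yS x * d (d F) + ode1 yS x * d F + ode0 yS x * F = 0 -> F = 0.
Proof.
move=> F0 ode; apply/fpsP => n; rewrite fps_coef0.
elim/ltn_ind: n => -[|n] IHn; first exact: F0.
have := congr1 (fun f : S => f n) ode; rewrite fps_coef0.
pose U : S := (1 - x ^+ 2) * (1 - yS * x) * (1 + (3 * yS - 4 * yS ^+ 3) * x) * (1 + 2 * yS * x).
have c0X (a : S) : (a * x) 0%N = 0 by rewrite fps_coef0M /= mulr0.
have U0 : U 0%N = 1.
  by rewrite /U !fps_coef0M !(fps_coefD, fps_coefN) expr2 !c0X oppr0 !addr0 !mulr1.
have V0 : (ode1 yS x) 0%N = 1 by rewrite fps_coefD fps_coef0M mul0r addr0.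
have -> : ode2 yS x * d (d F) = U * (x * d (d F)) by rewrite /ode2 /U; ring.
have xddF k : (x * d (d F)) k = F k.+1 *+ k.+1 *+ k by rewrite coef_fps_theta.
clearbody U; rewrite !fps_coefD.
rewrite (@coef_mul_low _ (x * d (d F))); last by move=> i lt_in; rewrite xddF IHn ?mul0rn.
rewrite (@coef_mul_low _ (d F)); last by move=> i lt_in /=; rewrite IHn ?mul0rn.
rewrite (@coef_mul_low _ F); last by move=> i lt_in; apply: IHn; rewrite ltnW.
rewrite U0 V0 !mul1r xddF (IHn n) // mulr0 addr0.
rewrite -[d F n]/(F n.+1 *+ n.+1) -mulrSr -mulr_natr -[F n.+1 *+ n.+1]mulr_natr => /eqP.
have nz k : k.+1%:R != 0 :> R by apply: contraTneq (natU k) => ->; rewrite unitr0.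
by rewrite !mulf_eq0 !(negbTE (nz _)) !orbF => /eqP.
Qed.

(** The recurrence is that of 2F1(1/4, 3/4; 1), as 16n(n + 1) + 3 = (4n + 1)(4n + 3). Its
    differential equation, with z substituted, feeds [hyp_ode_id]. *)
Lemma hyp_ode (g z : S) (hyp_coef : nat -> R) :
    scaled_p yS x * g ^+ 2 = 1 -> z = scaled_q yS x * g ^+ 4 ->
    (forall n, 16 * (hyp_coef n.+1 *+ (n.+1 * n.+1)) = (16 * (n * n.+1)%:R + 3) * hyp_coef n) ->
  let K := g * (FPS hyp_coef \oS z) in
  ode2 yS x * d (d K) + ode1 yS x * d K + ode0 yS x * K = 0.
Proof.
move=> pg zE phiE K; pose f : S := FPS hyp_coef.
have fode : 16%:R%:S * (x * d (d f) + d f - (x * x * d (d f) + 2%:R%:S * (x * d f))) = 3%:R%:S * f.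
  apply/fpsP => n; rewrite -expr2 !coef_fpsCM.
  rewrite !fps_coefD !fps_coefN !fps_coefD coef_fps_theta2 coef_fpsCM !coef_fps_theta /=.
  have /eqP := phiE n; rewrite -subr_eq0 => /eqP phi0.
  apply/eqP; rewrite -subr_eq0 -[X in _ == X]phi0; apply/eqP.
  case: n {phi0} => [|n] /=; ring.
have z0 : z 0%N = 0.
  rewrite zE /scaled_q 2!fps_coef0M fps_coefD fps_coefN.
  by rewrite !(fps_exp_low (g := x)) // subrr mulr0 mul0r.
have [pE p1E _ _] := der_hyp (@fps_derivM R) (fps_derivC y) (fps_derivX R).
have [z1E z2E] := der_hyp_arg (@fps_derivM R) (fps_derivC y) (fps_derivX R) pg.
have g1 := der_rsqrt (@fps_derivM R) pg; rewrite pE in g1.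
have g2 := der_rsqrt2 (@fps_derivM R) pg; rewrite pE p1E in g2.
pose u := f \oS z; pose v := d f \oS z; pose t := d (d f) \oS z.
have ode : 16 * (z * (1 - z) * t + (1 - 2 * z) * v) = 3 * u.
  have := congr1 (fun h => h \oS z) fode.
  rewrite !(fps_compM z0, fps_compD, fps_compN, fps_compC, fps_compX z0) -/u -/v -/t.
  by rewrite !rmorph_nat => <-; ring.
have z1 : d z = wronsk yS x * g ^+ 6 by rewrite zE.
have dK : d K = d g * u + g * (wronsk yS x * g ^+ 6) * v.
  by rewrite /K fps_derivM (fps_deriv_comp z0) z1 -/u -/v; ring.
have ddK : d (d K) = d (d g) * u + 2 * d g * (wronsk yS x * g ^+ 6) * v
    + g * ((wronsk1 yS x * g ^+ 6 - 3 * scaled_p1 yS x * wronsk yS x * g ^+ 8) * v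
           + (wronsk yS x * g ^+ 6) ^+ 2 * t).
  rewrite dK raddfD /= [d (d g * u)]fps_derivM [d (g * _ * v)]fps_derivM [d (g * _)]fps_derivM.
  by rewrite z2E !(fps_deriv_comp z0) z1 -/u -/v -/t; ring.
have U4 : (4%:R : S) \is a GRing.unit by apply/natr_unit_fps/natU.
apply: (mulrI U4); rewrite mulr0 ddK dK zE in ode *.
by rewrite -[RHS](hyp_ode_id pg g1 g2 ode) /K -/u; ring.
Qed.
End Ode.

(** * The generating function of the Legendre polynomials and the Hadamard product *)

Lemma legendre_gf_pde_id (T : comNzRingType) (w X g g1 g2 h1 h2 : T)
    (D := 1 - 2 * w * X + X ^+ 2) :
  D * g ^+ 2 = 1 ->
  2 * g1 = - g ^+ 3 * (2 * X - 2 * w) ->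
  4 * g2 = 3 * g ^+ 5 * (2 * X - 2 * w) ^+ 2 - 2 * g ^+ 3 * 2 ->
  2 * h1 = - g ^+ 3 * (- 2 * X) -> 4 * h2 = 3 * g ^+ 5 * (- 2 * X) ^+ 2 - 2 * g ^+ 3 * 0 ->
  4 * ((1 - w ^+ 2) * h2 - 2 * w * h1 + (X ^+ 2 * g2 + 2 * (X * g1))) = 0.
Proof.
move=> Dg e1 e2 f1 f2.
have g3 : g ^+ 3 = D * g ^+ 5 by rewrite -[LHS]mul1r -Dg; ring.
transitivity ((1 - w ^+ 2) * (4 * h2) - 4 * w * (2 * h1) + X ^+ 2 * (4 * g2)
  + 4 * X * (2 * g1)); first by ring.
by rewrite e1 e2 f1 f2 g3 /D; ring.
Qed.

Lemma fps_map_legendre_den (A B : comNzRingType) (f : {rmorphism A -> B}) a :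
  fps_map f (1 - 2 * a%:S * fpsX + fpsX ^+ 2) = 1 - 2 * (f a)%:S * fpsX + fpsX ^+ 2.
Proof.
rewrite -(fps_mapC f a) -(fps_mapX f).
by rewrite !(rmorphXn, rmorph_nat, rmorph1, rmorphB, rmorphD, rmorphM).
Qed.

Section LegendreSeries.
Variable (R : idomainType).
Hypothesis natU : forall n, (n.+1%:R : R) \is a GRing.unit.
Local Notation T := {poly R}.
Local Notation S := {fps {poly R}}.
Local Notation dX := (@fps_deriv T).
Local Notation dw := (fps_map (@deriv R)).
Local Notation wS := ('X%:S : S).

Definition legendre_den : S := 1 - 2 * wS * fpsX + fpsX ^+ 2.
Definition legendre_gf : S := (fps_sqrt legendre_den)^-1.

Lemma legendre_gfP : legendre_gf 0%N = 1 /\ legendre_den * legendre_gf ^+ 2 = 1.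
Proof.
apply: fps_rsqrtP; first exact: (poly_natU natU 1).
rewrite /legendre_den !fps_coefD fps_coefN expr2 !fps_coef0M.
by rewrite /= !mulr0 subr0 addr0.
Qed.

Lemma legop_legendre_gf n : legop (legendre_gf n) = - (n * n.+1)%:R *: legendre_gf n.
Proof.
have [_ Dk] := legendre_gfP.
have dXw : dX wS = 0 := fps_derivC _; have dXX : dX fpsX = 1 := fps_derivX _.
have dww : dw wS = 1 by rewrite fps_map_derivC derivX.
have dwX : dw fpsX = 0 := fps_map_deriv_fpsX _.
have X1 : dX legendre_den = 2 * fpsX - 2 * wS.
  rewrite /legendre_den expr2 raddfD raddfB /= !fps_derivM (der1 (@fps_derivM T)).
  by rewrite (der_nat (@fps_derivM T)) dXw dXX; ring.
have X2 : dX (2 * fpsX - 2 * wS) = 2.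
  rewrite raddfB /= !fps_derivM (der_nat (@fps_derivM T)) dXw dXX; ring.
have W1 : dw legendre_den = - 2 * fpsX.
  rewrite /legendre_den expr2 raddfD raddfB /= !fps_map_derivM (der1 (@fps_map_derivM R)).
  by rewrite (der_nat (@fps_map_derivM R)) dww dwX; ring.
have W2 : dw (- 2 * fpsX) = 0.
  by rewrite mulNr raddfN /= fps_map_derivM (der_nat (@fps_map_derivM R)) dwX; ring.
have g1 := der_rsqrt (@fps_derivM _) Dk; rewrite /= X1 in g1.
have g2 := der_rsqrt2 (@fps_derivM _) Dk; rewrite /= X1 X2 in g2.
have h1 := der_rsqrt (@fps_map_derivM _) Dk; rewrite /= W1 in h1.
have h2 := der_rsqrt2 (@fps_map_derivM _) Dk; rewrite /= W1 W2 in h2.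
have := legendre_gf_pde_id Dk g1 g2 h1 h2.
rewrite -[X in _ = X](mulr0 4) => /(mulrI (fps_poly_natU natU 3)).
have -> : 1 - wS ^+ 2 = (1 - 'X^2)%:S by rewrite !(rmorphXn, rmorphB).
have -> : 2 * wS = (2 * 'X)%:S by rewrite !(rmorphM, rmorph_nat).
have -> : 2 = (2%:R : T)%:S by rewrite rmorph_nat.
move=> /(congr1 (fun f : S => f n)).
rewrite !fps_coefD fps_coefN !coef_fpsCM coef_fps_theta2 coef_fps_theta.
rewrite -[dw (dw legendre_gf) n]/((legendre_gf n)^`()^`()).
rewrite -[dw legendre_gf n]/((legendre_gf n)^`()) -/(legop (legendre_gf n)).
rewrite fps_coef0 => /eqP; rewrite addr_eq0 => /eqP ->.
rewrite -mul_polyC rmorphN /= polyC_natr.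
by case: n => [|n] /=; ring.
Qed.

Lemma legendre_gf_horner1 n : (legendre_gf n).[1] = 1.
Proof.
have [k0 Dk] := legendre_gfP; pose e := fps_map (horner_eval (1 : R)) legendre_gf.
have e0 : e 0%N = 1 by rewrite /= k0 rmorph1.
have De : (1 - fpsX) ^+ 2 * e ^+ 2 = 1.
  transitivity (fps_map (horner_eval (1 : R)) (legendre_den * legendre_gf ^+ 2));
    last by rewrite Dk rmorph1.
  rewrite rmorphM rmorphXn; congr (_ * _).
  apply/esym; apply: etrans (fps_map_legendre_den (horner_eval (1 : R)) 'X) _.
  by rewrite /= /horner_eval hornerX (_ : (1 : R)%:S = 1) //; ring.
pose b : {fps R} := FPS (fun n => 1).
have bE : (1 - fpsX) * b = 1.
  apply/fpsP => -[|m]; rewrite mulrBl mul1r fps_coefD fps_coefN coef_fpsXM /= ?subr0 //.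
  by rewrite subrr.
have Db : (1 - fpsX) ^+ 2 * b ^+ 2 = 1 by rewrite -exprMn bE expr1n.
by have /fpsP/(_ n) := fps_rsqrt_unique (natU 1) e0 (erefl : b 0%N = 1) De Db.
Qed.

(** Serves to identify the polynomials of the Rodrigues formula with the coefficients of (1 - 2wX +
    X^2)^(-1/2). *)
Lemma legendre_gf_unique p n :
  legop p = - (n * n.+1)%:R *: p -> p.[1] = 1 -> p = legendre_gf n.
Proof.
move=> pE p1; apply/eqP; rewrite -subr_eq0; apply/eqP.
apply: (@legop_eigen_unique R _ (- (n * n.+1)%:R)) => [k||].
- by apply: contraTneq (natU k) => ->; rewrite unitr0.
- by rewrite linearB /= pE legop_legendre_gf -scalerBr.
- by rewrite hornerD hornerN p1 legendre_gf_horner1 subrr.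
Qed.

Local Notation cst := (fps_map (@polyC R)).
Local Notation inv_sqrt_14X := ((fps_sqrt (1 - 4 * fpsX : {fps R}))^-1).
Local Notation inv_sqrt_1X2 := ((fps_sqrt (1 + fpsX ^+ 2 : {fps R}))^-1).
Local Notation Z := (fpsX / (1 + fpsX ^+ 2) : {fps R}).

Lemma fpsX_div0 : Z 0%N = 0.
Proof. by rewrite fps_coef0M mul0r. Qed.

(** From 1 - 2tX + X^2 = (1 + X^2)(1 - 2tZ), where (1 - 2tZ)^(-1/2) is (1 - 4x)^(-1/2) at x = tZ/2.
    Both sides are inverse square roots of [legendre_den] with constant term 1. *)
Lemma legendre_gf_factor :
  legendre_gf = cst inv_sqrt_1X2 * (fps_scale (2^-1 *: 'X) (cst inv_sqrt_14X) \oS cst Z).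
Proof.
have U2 := natU 1.
have [a0 Da] : inv_sqrt_1X2 0%N = 1 /\ (1 + fpsX ^+ 2) * inv_sqrt_1X2 ^+ 2 = 1.
  by apply: fps_rsqrtP => //; rewrite fps_coefD expr2 fps_coef0M /= mul0r addr0.
have [b0 Db] : inv_sqrt_14X 0%N = 1 /\ (1 - 4 * fpsX) * inv_sqrt_14X ^+ 2 = 1.
  by apply: fps_rsqrtP => //; rewrite fps_coefD fps_coefN fps_coef0M /= mulr0 subr0.
have UZ : (1 + fpsX ^+ 2 : {fps R}) \is a GRing.unit.
  by rewrite fps_unitE fps_coefD expr2 fps_coef0M /= mul0r addr0 unitr1.
set B := fps_scale _ _; set z := cst Z.
have z0 : z 0%N = 0 by move: (congr1 (@polyC R) fpsX_div0); rewrite polyC0.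
have zE : (1 + fpsX ^+ 2) * z = fpsX.
  transitivity (cst ((1 + fpsX ^+ 2) * Z)); last by rewrite mulrC divrK // fps_mapX.
  by rewrite rmorphM; congr (_ * _); rewrite rmorphD rmorphXn rmorph1 /= fps_mapX.
have DB : (1 - 2 * wS * fpsX) * B ^+ 2 = 1.
  have := congr1 (fun h => fps_scale (2^-1 *: 'X) (cst h)) Db.
  rewrite !(rmorphXn, rmorphM, rmorph1) => E; rewrite -[RHS]E; congr (_ * _).
  rewrite !rmorphB !rmorphM !rmorph_nat !rmorph1 /= fps_mapX fps_scaleX mulrA -mul_polyC.
  rewrite -(rmorph_nat (@fpsC T) 4) -(rmorph_nat (@fpsC T) 2) -!rmorphM; congr (1 - _%:S * _).
  have -> : 4 = 2 * (2%:R)%:P :> T by rewrite polyC_natr -natrM.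
  by rewrite mulrA -[2 * _ * _]mulrA -polyCM mulrV // polyC1 mulr1.
have DBz : (1 - 2 * wS * z) * (B \oS z) ^+ 2 = 1.
  have := congr1 (fun h => h \oS z) DB; rewrite expr2 -(rmorph_nat (@fpsC T)).
  rewrite !(fps_compM z0, fps_compD, fps_compN, fps_compC, fps_compX z0) rmorph_nat.
  by rewrite -expr2 (rmorph_nat (@fpsC T) 2 : (2 : T)%:S = 2).
have [l0 Dl] := legendre_gfP.
apply: (fps_rsqrt_unique (poly_natU natU 1) l0 _ Dl).
  by rewrite fps_coef0M fps_comp0 /= a0 b0 expr0 !mul1r.
transitivity (((1 + fpsX ^+ 2) * cst inv_sqrt_1X2 ^+ 2) * ((1 - 2 * wS * z) * (B \oS z) ^+ 2)).
  rewrite /legendre_den -{1}zE; ring.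
rewrite DBz mulr1.
transitivity (cst ((1 + fpsX ^+ 2) * inv_sqrt_1X2 ^+ 2)); last by rewrite Da rmorph1.
rewrite !(rmorphXn, rmorphM); congr (_ * _).
by rewrite rmorphD rmorphXn rmorph1 /= fps_mapX.
Qed.

(** Coefficient n of (1 - 4x)^(-1/2) at x = tX/2 carries (t/2)^n, which the functional sends to
    k_n/2^n = h_n; this produces the Hadamard product with h. *)
Lemma umbral_legendre_gf (k : nat -> R) (h : {fps R}) :
  (forall n, k n = 2 ^+ n * h n) ->
  fps_map (umbral (V := R^o) k) legendre_gf = inv_sqrt_1X2 * ((h ⋆ inv_sqrt_14X) \oS Z).
Proof.
move=> kE; rewrite legendre_gf_factor fps_map_cstM_linear fps_map_comp_linear.
congr (_ * (_ \oS _)); apply/fpsP => n.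
rewrite -[LHS]/(umbral (V := R^o) k ((2^-1 *: 'X) ^+ n * (inv_sqrt_14X n)%:P)).
rewrite mulrC mul_polyC exprZn !linearZ /= umbralXn kE /GRing.scale /=.
by rewrite (mulrA (2^-1 ^+ n)) -exprMn mulVr // expr1n mul1r mulrC.
Qed.

End LegendreSeries.

Lemma fps_scale_comp (R : comNzRingType) (c : R) (f g : {fps R}) :
  fps_scale c (f \oS g) = f \oS fps_scale c g.
Proof.
apply/fpsP => n; rewrite /= mulr_sumr; apply: eq_bigr => i _.
by rewrite -rmorphXn /= mulrCA.
Qed.

(** * Identification of the diagonal series with H *)

Section Hypergeometric.
Variables (R : idomainType) (y : R).
Hypothesis natU : forall n, (n.+1%:R : R) \is a GRing.unit.
Local Notation S := {fps R}.
Local Notation yS := (y%:S : S).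
Local Notation x := (fpsX : S).

Definition hyp_coef n : R :=
  pochhammer (1 / 4) n * pochhammer (3 / 4) n / (n`!%:R * pochhammer 1 n).

Lemma pochhammerS (a : R) n : pochhammer a n.+1 = pochhammer a n * (a + n%:R).
Proof. by rewrite /pochhammer big_ord_recr. Qed.

Lemma pochhammer1 n : pochhammer (1 : R) n = n`!%:R.
Proof.
elim: n => [|n IHn]; first by rewrite /pochhammer big_ord0.
by rewrite pochhammerS IHn factS mulnC natrM -[n.+1]add1n natrD.
Qed.

Lemma fact_unit n : (n`!%:R : R) \is a GRing.unit.
Proof. by rewrite -(prednK (fact_gt0 n)). Qed.

Lemma hyp_coef_rec n :
  16 * (hyp_coef n.+1 *+ (n.+1 * n.+1)) = (16 * (n * n.+1)%:R + 3) * hyp_coef n.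
Proof.
rewrite /hyp_coef !pochhammer1 !pochhammerS factS.
set A := pochhammer _ n; set B := pochhammer _ n; set f : R := n`!%:R.
have Uf : f * f \is a GRing.unit by rewrite unitrM fact_unit.
have Un : n.+1%:R * n.+1%:R \is a @GRing.unit R by rewrite unitrM natU.
have -> : (n.+1 * n`!)%:R * (n.+1 * n`!)%:R = (f * f) * (n.+1%:R * n.+1%:R).
  by rewrite natrM -/f; ring.
rewrite invrM // -[_ *+ (n.+1 * n.+1)]mulr_natr [(n.+1 * n.+1)%:R]natrM.
set N : R := n.+1%:R * n.+1%:R in Un *.
have -> : 16 * (A * (1 / 4 + n%:R) * (B * (3 / 4 + n%:R)) * (N^-1 / (f * f)) * N) =
   (4 * (1 / 4 + n%:R)) * (4 * (3 / 4 + n%:R)) * (A * B / (f * f)) * (N^-1 * N).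
  by ring.
rewrite mulVr // mulr1; congr (_ * _).
have q a : 4 * (a / 4 + n%:R) = a + 4 * n%:R :> R by rewrite mulrDr mulrCA divrr ?mulr1 ?natU.
by rewrite !q; ring.
Qed.

(* At y = 'X over {poly rat}, gen_H is convertible to H_series; a generic base ring keeps
   unification away from the concrete instances on {poly rat}. *)
Definition gen_p : S := 1 - x * yS ^+ 3 + x ^+ 2 * (3 * yS ^+ 2 - 2) / 4.
Definition gen_arg : S := (yS ^+ 2 - 1) ^+ 3 * (x ^+ 2 - 1 / 4 * x ^+ 4) / gen_p ^+ 2.
Definition gen_H : S := (fps_sqrt gen_p)^-1 * hyp2F1 (1 / 4) (3 / 4) 1 gen_arg.

Lemma scale_gen_p : fps_scale 2 gen_p = scaled_p yS x.
Proof.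
have U4 : (4 : S) \is a GRing.unit by apply/natr_unit_fps/natU.
rewrite /gen_p /scaled_p; apply: (mulIr U4).
have scale4 (f : S) : fps_scale 2 f * 4 = fps_scale 2 (f * 4) by rewrite rmorphM rmorph_nat.
rewrite scale4 mulrDl divrK //.
rewrite !(rmorphXn, rmorph_nat, rmorph1, rmorphB, rmorphD, rmorphM) /= fps_scaleX fps_scaleC.
by rewrite (rmorph_nat (@fpsC R) 2); ring.
Qed.

Lemma gen_p0 : gen_p 0%N = 1.
Proof.
by rewrite /gen_p !(fps_coefD, fps_coefN, fps_coef0M, exprS) /= !mul0r oppr0 !addr0.
Qed.

Lemma diag_kernel_gen_H n : diag_kernel y n = 2 ^+ n * gen_H n.
Proof.
pose g := fps_scale 2 (fps_sqrt gen_p)^-1; pose z := fps_scale 2 gen_arg.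
have [s0 Ds] := fps_rsqrtP (natU 1) gen_p0.
have g0 : g 0%N = 1 by rewrite /= s0 expr0 mulr1.
have pg : scaled_p yS x * g ^+ 2 = 1 by rewrite -scale_gen_p -rmorphXn -rmorphM Ds rmorph1.
have U4 : (4 : S) \is a GRing.unit by apply/natr_unit_fps/natU.
have zE : z = scaled_q yS x * g ^+ 4.
  have Up : gen_p ^+ 2 \is a GRing.unit by rewrite unitrX // fps_unitE gen_p0 unitr1.
  have p4 : scaled_p yS x ^+ 2 * g ^+ 4 = 1 by rewrite -(expr1n _ 2) -pg; ring.
  have zp : z * scaled_p yS x ^+ 2 = scaled_q yS x.
    rewrite -scale_gen_p -rmorphXn -rmorphM divrK //; apply: (mulIr U4).
    have scale4 (f : S) : fps_scale 2 f * 4 = fps_scale 2 (f * 4) by rewrite rmorphM rmorph_nat.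
    rewrite scale4.
    have -> : (yS ^+ 2 - 1) ^+ 3 * (x ^+ 2 - 1 / 4 * x ^+ 4) * 4 =
       (yS ^+ 2 - 1) ^+ 3 * (4 * x ^+ 2 - (4 / 4) * x ^+ 4) by ring.
    rewrite divrr // mul1r.
    rewrite !(rmorphXn, rmorph_nat, rmorph1, rmorphB, rmorphD, rmorphM) /= fps_scaleX fps_scaleC.
    by rewrite (rmorph_nat (@fpsC R) 2) /scaled_q; ring.
  by rewrite -[LHS]mulr1 -p4 mulrA zp.
have hE : fps_scale 2 gen_H = g * (FPS hyp_coef \oS z).
  by rewrite /gen_H rmorphM /=; congr (_ * _); apply: fps_scale_comp.
have z0 : z 0%N = 0.
  rewrite zE /scaled_q 2!fps_coef0M fps_coefD fps_coefN.
  by rewrite !(fps_exp_low (g := x)) // subrr mulr0 mul0r.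
have ode := hyp_ode natU pg zE hyp_coef_rec; rewrite /= -hE in ode.
suff /eqP : diag_kernel y - fps_scale 2 gen_H = 0 by rewrite subr_eq0 => /eqP ->.
apply: (ode_unique natU (y := y)).
  have [k0 _] := kernelP y natU.
  have kd0 : diag_kernel y 0%N = 1.
    by rewrite -[LHS]/(diag y (kernel y 0%N)) k0 -(expr0 'X) /diag umbralXn k0 hornerC.
  have phi0 : hyp_coef 0 = 1 by rewrite /hyp_coef /pochhammer !big_ord0 fact0 !mulr1 divr1.
  by rewrite fps_coefD fps_coefN kd0 hE fps_coef0M g0 fps_comp0 mul1r /= phi0 subrr.
have k := diag_kernel_ode y natU.
by rewrite !raddfB /=; apply/eqP; rewrite -[X in _ == X](subrr 0) -{1}k -ode; apply/eqP; ring.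
Qed.
End Hypergeometric.

Theorem theorem5 :
  let x : {fps {poly rat}} := fpsX in
  let z : {fps {poly rat}} := fpsX in
  legendre_cube_gf =
  (fps_sqrt (1 + z ^+ 2))^-1 *
  ((H_series ⋆ (fps_sqrt (1 - 4 * x))^-1) \oS (z / (1 + z ^+ 2))).
Proof.
(* The base ring is Q[y] with y = ['X], and the variable t of the kernel is that of polynomials over
   it. *)
move=> x z; have kE := diag_kernel_gen_H ('X : {poly rat}) poly_natr_unit.
rewrite -[RHS](umbral_legendre_gf poly_natr_unit kE); apply/fpsP => n.
(* P_n(t) with its rational coefficients read as constants of Q[y]; its eigenvalue and its value at
   1 single out coefficient n of [legendre_gf]. *)
pose p : {poly {poly rat}} := map_poly polyC (legendre n).
have legop_p : legop p = - (n * n.+1)%:R *: p.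
  have := congr1 (map_poly (@polyC rat)) (legop_legendre n).
  rewrite /p /legop map_polyZ rmorphN /= polyC_natr => <-.
  rewrite rmorphB !rmorphM rmorphB rmorph_nat rmorph1 /= map_polyXn map_polyX.
  by rewrite !deriv_map.
have p1 : p.[1] = 1.
  by rewrite /p -(rmorph1 (@polyC rat)) horner_map legendre1 /= rmorph1.
rewrite -[RHS]/(umbral (V := ({poly rat})^o) (diag_kernel 'X) (legendre_gf _ n)).
rewrite -(legendre_gf_unique poly_natr_unit legop_p p1).
rewrite (umbral_diag_kernel 'X poly_natr_unit legop_p p1).
(* Evaluation at t = y undoes the embedding: p(y) is P_n composed with the variable. *)
by congr (_ ^+ 3); rewrite -[RHS]/(legendre n \Po 'X) comp_polyXr.
Qed.
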